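(* Let $\omega:\mathbb{R}\to\mathbb{R}$ satisfy: (i) $\omega$ even; (ii) $\omega(x)\to0$ as $|x|\to\infty$ and $|\omega(x)|\le C(1+|x|)^{-1-\delta}$ for constants $C,\delta>0$; (iii) $\omega$ bounded, Lipschitz continuous and integrable; (iv) $\int_{\mathbb{R}}\omega>0$. Let $h\in\mathbb{R}$, $T>0$, and let $u_p$ be a regular 1-bump periodic solution with period $T$ of $u(x)=\int_{\mathbb{R}}\omega(x-y)H(u(y)-h)\,dy$ with $u_p(\pm a)=h$, $0<a<T/2$. Let $L:\ell^2_\infty(\mathbb{Z})\to\ell^2_\infty(\mathbb{Z})$ be the block Laurent operator $(L\mathrm{x})_i=\sum_jA_{i-j}\mathrm{x}_j$ with $A_k=\frac{1}{|u_p'(a)|}\begin{pmatrix}\omega(kT)&\omega(-2a+kT)\\ \omega(2a+kT)&\omega(kT)\end{pmatrix}$. For $q=1,2,\dots$ let $L(1+q)$ be the $2(1+q)\times2(1+q)$ block circulant matrix $$L(1+q)=\begin{pmatrix}B_0&B_1&B_2&\cdots&B_q\\ B_q&B_0&B_1&\cdots&B_{q-1}\\ \vdots&&&&\vdots\\ B_1&B_2&B_3&\cdots&B_0\end{pmatrix},\quad B_n=\frac{1}{|u_p'(a)|}\begin{pmatrix}\omega_p(nT;(1+q)T)&\omega_p(-2a+nT;(1+q)T)\\ \omega_p(2a+nT;(1+q)T)&\omega_p(nT;(1+q)T)\end{pmatrix},$$ $n=0,\dots,q$, where $\omega_p(x;P)=\sum_{k\in\mathbb{Z}}\omega(x-kP)$.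 Then $$\sigma(L)=\operatorname{cl}\Big(\bigcup_{q\ge1}\sigma\big(L(1+q)\big)\Big).$$
   Context: $H$ is the unit step function. A continuous $T$-periodic function $u$ is regular 1-bump periodic (threshold $h$) if it is bounded with bounded continuous derivative and a translate $p$ satisfies $p(\pm a)=h$, $p>h$ on $(-a,a)$, $p<h$ on $[-T/2,T/2]\setminus[-a,a]$, $p'(\pm a)\neq0$. $\ell^2_\infty(\mathbb{Z})$ is the space of bounded two-sided sequences with entries in $\mathbb{C}^2$ with the sup norm; $\sigma$ denotes spectrum and $\operatorname{cl}$ closure in $\mathbb{C}$. *)

(* Defs.v *)
From Stdlib Require Import Reals Lra ZArith.
From Coquelicot Require Import Coquelicot.
Open Scope R_scope.

(* Unit step function, convention H(0) = 0 (irrelevant up to null sets). *)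
Definition H (s : R) : R := if Rlt_dec 0 s then 1 else 0.

Definition Zsum (f : Z -> R) : R :=
  Series (fun n => f (Z.of_nat n)) + Series (fun n => f (- Z.of_nat (S n))%Z).

Definition CZsum (f : Z -> C) : C := (Zsum (fun k => fst (f k)), Zsum (fun k => snd (f k))).

Definition omega_p (omega : R -> R) (x P : R) : R := Zsum (fun k => omega (x - IZR k * P)).

Definition blk (f : R -> R) (c a s : R) (x : C * C) : C * C :=
  (Cplus (Cmult (RtoC (f s / c)) (fst x)) (Cmult (RtoC (f (-2 * a + s) / c)) (snd x)),
   Cplus (Cmult (RtoC (f (2 * a + s) / c)) (fst x)) (Cmult (RtoC (f s / c)) (snd x))).

Definition bdd_seq (x : Z -> C * C) : Prop :=
  exists M : R, forall i : Z, Cmod (fst (x i)) <= M /\ Cmod (snd (x i)) <= M.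

Definition Lop (omega : R -> R) (T a c : R) (x : Z -> C * C) (i : Z) : C * C :=
  (CZsum (fun j => fst (blk omega c a (IZR (i - j) * T) (x j))),
   CZsum (fun j => snd (blk omega c a (IZR (i - j) * T) (x j)))).

Definition vsub (x y : C * C) : C * C := (Cminus (fst x) (fst y), Cminus (snd x) (snd y)).
Definition vscal (l : C) (x : C * C) : C * C := (Cmult l (fst x), Cmult l (snd x)).
Definition vadd (x y : C * C) : C * C := (Cplus (fst x) (fst y), Cplus (snd x) (snd y)).

Definition in_spectrum_L (omega : R -> R) (T a c : R) (lam : C) : Prop :=
  ~ (forall y : Z -> C * C, bdd_seq y ->
       exists! x : Z -> C * C, bdd_seq x /\
         (forall i : Z, vsub (Lop omega T a c x i) (vscal lam (x i)) = y i)).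

Fixpoint vsum (n : nat) (f : nat -> C * C) : C * C :=
  match n with
  | O => (RtoC 0, RtoC 0)
  | S m => vadd (vsum m f) (f m)
  end.

(* The block circulant matrix L(1+q) applied to v : C^{2(1+q)} (v given block-wise,
   blocks indexed by 0..q):  block row r, block column c holds B_{(c - r) mod (1+q)},
   B_n = (1/cc) [[w(nT), w(-2a+nT)], [w(2a+nT), w(nT)]],  w = omega_p(. ; (1+q)T). *)
Definition circ_apply (omega : R -> R) (T a cc : R) (q : nat) (v : nat -> C * C) (r : nat)
  : C * C :=
  vsum (S q) (fun col =>
    blk (fun x => omega_p omega x (INR (S q) * T)) cc a
        (INR ((col + S q - r) mod (S q)) * T) (v col)).

Definition in_spectrum_circ (omega : R -> R) (T a cc : R) (q : nat) (lam : C) : Prop :=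
  exists v : nat -> C * C,
    (exists r, (r < S q)%nat /\ v r <> (RtoC 0, RtoC 0)) /\
    (forall r, (r < S q)%nat -> circ_apply omega T a cc q v r = vscal lam (v r)).

(* Main.v *)
(* A band-dominated operator that commutes with the shifts acts on the character
   e_t(k) = exp(ikt) as a scalar, its symbol at t, and by a form of Wiener's lemma it is bijective
   on bounded sequences as soon as its symbol has no zero.  Cramer's rule reduces the block operator
   L - lam to its determinant, so lam lies in the spectrum of L if and only if it is an eigenvalue
   of the two by two symbol matrix Phi(t) for some t; as Phi is continuous and periodic, the
   spectrum is closed.  Up to a reflection, L(1+q) is L acting on (1+q)-periodic sequences.  Hence
   its eigenvalues lie in the spectrum of L and contain those of Phi(2 pi j / (1+q)), and these
   are dense in the spectrum of L because the roots of unity are dense in the circle. *)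
Require Import Defs.
From Stdlib Require Import Reals ZArith Lra Lia FunctionalExtensionality Classical.
From Coquelicot Require Import Coquelicot.
Open Scope R_scope.

(** * Estimates *)

Lemma exists_small_mult_le (K eps : R) : 0 < eps -> exists e, 0 < e <= 1 /\ K * e <= eps.
Proof.
  intros Heps. assert (HK := Rabs_pos K). exists (Rmin 1 (eps / (Rabs K + 1))).
  assert (Hpos : 0 < eps / (Rabs K + 1)) by (apply Rdiv_lt_0_compat; lra).
  split.
  - split; [apply Rmin_pos; lra|apply Rmin_l].
  - assert (Hmin := Rmin_r 1 (eps / (Rabs K + 1))).
    assert (Hmin0 : 0 < Rmin 1 (eps / (Rabs K + 1))) by (apply Rmin_pos; lra).
    assert (Heq : (Rabs K + 1) * (eps / (Rabs K + 1)) = eps) by (field; lra).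
    generalize (Rle_abs K). nra.
Qed.

Lemma nonpos_of_le_small_mult (K r : R) : (forall e, 0 < e <= 1 -> r <= K * e) -> r <= 0.
Proof.
  intros Hr. apply le_epsilon. intros eps Heps. rewrite Rplus_0_l.
  destruct (exists_small_mult_le K eps Heps) as (e & He & HKe).
  apply Rle_trans with (2 := HKe). now apply Hr.
Qed.

Lemma nonpos_of_le_geometric (K s r : R) :
  0 <= s < 1 -> (forall n : nat, r <= K * s ^ n) -> r <= 0.
Proof.
  intros Hs Hr. apply nonpos_of_le_small_mult with (Rabs K). intros e He.
  destruct (pow_lt_1_zero s ltac:(rewrite Rabs_pos_eq; lra) e (proj1 He)) as [N HN].
  specialize (HN N (le_n N)). specialize (Hr N).
  assert (Hpow : 0 <= s ^ N) by (apply pow_le; lra).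
  rewrite Rabs_pos_eq in HN by exact Hpow.
  generalize (Rle_abs K) (Rabs_pos K). nra.
Qed.

Lemma affine_mult_pow_le (a b q r : R) :
  0 <= a -> 0 <= b -> 0 < q < r ->
  exists K, forall n, (a * INR n + b) * q ^ n <= K * r ^ n.
Proof.
  intros Ha Hb Hqr. set (u := r / q - 1).
  assert (Hu : 0 < u).
  { unfold u. enough (1 < r / q) by lra. apply Rlt_div_r; lra. }
  exists (a / u + b). intros n.
  assert (Hr : r ^ n = q ^ n * (1 + u) ^ n).
  { rewrite <- Rpow_mult_distr. f_equal. unfold u. field. lra. }
  assert (Bernoulli := poly n u Hu).
  assert (Hq : 0 < q ^ n) by (apply pow_lt; lra).
  assert (Hau0 : 0 <= a / u) by (apply Rdiv_le_0_compat; lra).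
  assert (Hnu : 0 <= b * (INR n * u)) by (repeat apply Rmult_le_pos; try apply pos_INR; lra).
  assert (Hlin : a * INR n + b <= (a / u + b) * (1 + INR n * u)).
  { replace ((a / u + b) * (1 + INR n * u)) with (a / u + a * INR n + b + b * (INR n * u))
      by (field; lra).
    lra. }
  rewrite Hr, <- Rmult_assoc, (Rmult_comm _ (q ^ n)), (Rmult_comm _ (q ^ n)), Rmult_assoc.
  apply Rmult_le_compat_l; [lra|].
  apply Rle_trans with (1 := Hlin). apply Rmult_le_compat_l; lra.
Qed.

Lemma Cmod_minus_le (x y : C) : Cmod (x - y) <= Cmod x + Cmod y.
Proof. rewrite <- (Cmod_opp y). apply Cmod_triangle. Qed.

Lemma Cmod_minus_sym (x y : C) : Cmod (x - y) = Cmod (y - x).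
Proof. now rewrite <- Cmod_opp, Copp_minus_distr. Qed.

Lemma Cmod_dist_triangle (x y z : C) : Cmod (x - z) <= Cmod (x - y) + Cmod (y - z).
Proof.
  replace (x - z)%C with ((x - y) + (y - z))%C by ring. apply Cmod_triangle.
Qed.

Lemma Rabs_Cmod_minus_le (x y : C) : Rabs (Cmod x - Cmod y) <= Cmod (x - y).
Proof.
  assert (Hx := Cmod_triangle (x - y) y). assert (Hy := Cmod_triangle (y - x) x).
  replace (x - y + y)%C with x in Hx by ring. replace (y - x + x)%C with y in Hy by ring.
  rewrite Cmod_minus_sym in Hy. apply Rabs_le. lra.
Qed.

Lemma Cmod_le_Rabs (z : C) : Cmod z <= Rabs (fst z) + Rabs (snd z).
Proof.
  destruct z as [u v]. unfold Cmod; cbn [fst snd].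
  assert (Hu := Rabs_pos u). assert (Hv := Rabs_pos v).
  rewrite <- (sqrt_pow2 (Rabs u + Rabs v)) by lra.
  apply sqrt_le_1_alt. rewrite <- (pow2_abs u), <- (pow2_abs v). nra.
Qed.

Lemma Rabs_fst_le_Cmod (z : C) : Rabs (fst z) <= Cmod z.
Proof. apply Rle_trans with (2 := Rmax_Cmod z). apply Rmax_l. Qed.

Lemma Rabs_snd_le_Cmod (z : C) : Rabs (snd z) <= Cmod z.
Proof. apply Rle_trans with (2 := Rmax_Cmod z). apply Rmax_r. Qed.

Lemma Ceq_of_Cmod_le_small_mult (K : R) (x y : C) :
  (forall e, 0 < e <= 1 -> Cmod (x - y) <= K * e) -> x = y.
Proof.
  intros Hxy. apply Ceq_minus, Cmod_eq_0, Rle_antisym; [|apply Cmod_ge_0].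
  exact (nonpos_of_le_small_mult K _ Hxy).
Qed.

Lemma Csqrt_exists (z : C) : exists w : C, (w * w)%C = z.
Proof.
  destruct z as [x y]. set (r := Cmod (x, y)).
  assert (Hr : r * r = x * x + y * y).
  { unfold r, Cmod; cbn [fst snd]. rewrite sqrt_sqrt; nra. }
  assert (Hx : - r <= x <= r) by (apply Rabs_le_between, (Rabs_fst_le_Cmod (x, y))).
  set (u := sqrt ((r + x) / 2)). set (v := sqrt ((r - x) / 2)).
  assert (Hu : u * u = (r + x) / 2) by (apply sqrt_sqrt; lra).
  assert (Hv : v * v = (r - x) / 2) by (apply sqrt_sqrt; lra).
  assert (Huv : 2 * (u * v) = Rabs y).
  { unfold u, v. rewrite <- sqrt_mult by lra.
    replace ((r + x) / 2 * ((r - x) / 2)) with (Rsqr (y / 2)).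
    - rewrite sqrt_Rsqr_abs. unfold Rdiv. rewrite Rabs_mult, (Rabs_pos_eq (/ 2)) by lra. field.
    - unfold Rsqr. transitivity ((r * r - x * x) / 4); [rewrite Hr|]; field. }
  destruct (Rle_dec 0 y) as [Hy|Hy].
  - exists (u, v). rewrite Rabs_pos_eq in Huv by exact Hy.
    unfold Cmult; cbn [fst snd]. f_equal; lra.
  - exists (u, - v). rewrite Rabs_left in Huv by lra.
    unfold Cmult; cbn [fst snd]. f_equal; lra.
Qed.

(** * Finite sums of complex numbers *)

Fixpoint csum (n : nat) (f : nat -> C) : C :=
  match n with
  | O => 0
  | S m => (csum m f + f m)%C
  end.

Lemma csum_ext (n : nat) (f g : nat -> C) :
  (forall k, (k < n)%nat -> f k = g k) -> csum n f = csum n g.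
Proof.
  induction n as [|n IH]; intros Hfg; simpl; [reflexivity|].
  rewrite IH, Hfg by (intros; try apply Hfg; lia). reflexivity.
Qed.

Lemma csum_plus (n : nat) (f g : nat -> C) :
  csum n (fun k => f k + g k)%C = (csum n f + csum n g)%C.
Proof. induction n as [|n IH]; simpl; [ring|]. rewrite IH. ring. Qed.

Lemma csum_scal (n : nat) (c : C) (f : nat -> C) :
  csum n (fun k => c * f k)%C = (c * csum n f)%C.
Proof. induction n as [|n IH]; simpl; [ring|]. rewrite IH. ring. Qed.

Lemma csum_zero (n : nat) (f : nat -> C) :
  (forall k, (k < n)%nat -> f k = 0) -> csum n f = 0.
Proof.
  induction n as [|n IH]; intros Hf; simpl; [reflexivity|].
  rewrite IH, Hf by (intros; try apply Hf; lia). ring.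
Qed.

Lemma csum_const (n : nat) (c : C) : csum n (fun _ => c) = (RtoC (INR n) * c)%C.
Proof.
  induction n as [|n IH]; [simpl; ring|].
  cbn [csum]. rewrite IH, S_INR, RtoC_plus. ring.
Qed.

Lemma csum_swap (n m : nat) (f : nat -> nat -> C) :
  csum n (fun i => csum m (fun j => f i j)) = csum m (fun j => csum n (fun i => f i j)).
Proof.
  induction n as [|n IH]; simpl.
  - symmetry. now apply csum_zero.
  - rewrite IH, <- csum_plus. reflexivity.
Qed.

Lemma csum_add (n m : nat) (f : nat -> C) :
  csum (n + m) f = (csum n f + csum m (fun k => f (n + k)%nat))%C.
Proof.
  induction m as [|m IH]; simpl.
  - rewrite Nat.add_0_r. ring.
  - rewrite Nat.add_succ_r. simpl. rewrite IH. ring.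
Qed.

Lemma csum_first (n : nat) (f : nat -> C) :
  csum (S n) f = (f O + csum n (fun k => f (S k)))%C.
Proof. change (S n) with (1 + n)%nat. rewrite csum_add. simpl. ring. Qed.

Lemma csum_single (n m : nat) (f : nat -> C) :
  (m < n)%nat -> (forall k, (k < n)%nat -> k <> m -> f k = 0) -> csum n f = f m.
Proof.
  intros Hm Hf. replace n with (m + S (n - m - 1))%nat by lia.
  rewrite csum_add, csum_first, Nat.add_0_r, !csum_zero by (intros; apply Hf; lia). ring.
Qed.

Lemma csum_mul (n m : nat) (f : nat -> C) :
  csum (n * m) f = csum n (fun i => csum m (fun j => f (i * m + j)%nat)).
Proof.
  induction n as [|n IH]; [reflexivity|].
  replace (S n * m)%nat with (n * m + m)%nat by lia.
  rewrite csum_add. cbn [csum]. now rewrite IH.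
Qed.

Lemma Cmod_csum_le (n : nat) (f : nat -> C) (M : R) :
  (forall k, (k < n)%nat -> Cmod (f k) <= M) -> Cmod (csum n f) <= INR n * M.
Proof.
  induction n as [|n IH]; intros Hf.
  - simpl. rewrite Cmod_0. lra.
  - cbn [csum]. rewrite S_INR. eapply Rle_trans; [apply Cmod_triangle|].
    assert (Cmod (csum n f) <= INR n * M) by (apply IH; intros; apply Hf; lia).
    generalize (Hf n (Nat.lt_succ_diag_r n)). lra.
Qed.

(** * Characters of the integers *)

Definition cis (t : R) : C := (cos t, sin t).

Lemma cis_plus (s t : R) : cis (s + t) = (cis s * cis t)%C.
Proof. unfold cis, Cmult; cbn [fst snd]. rewrite cos_plus, sin_plus. f_equal; ring. Qed.

Lemma cis_0 : cis 0 = 1.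
Proof. unfold cis. now rewrite cos_0, sin_0. Qed.

Lemma cis_2PI : cis (2 * PI) = 1.
Proof. unfold cis. now rewrite cos_2PI, sin_2PI. Qed.

Lemma cis_neq_1 (t : R) : 0 < Rabs t < 2 * PI -> cis t <> 1.
Proof.
  intros [Ht0 Ht] E. injection E as Ecos _.
  assert (Hcos : cos (Rabs t) = 1) by (unfold Rabs; destruct (Rcase_abs t); now rewrite ?cos_neg).
  replace (Rabs t) with (2 * (Rabs t / 2)) in Hcos by field.
  rewrite cos_2a_sin in Hcos.
  assert (0 < sin (Rabs t / 2)) by (apply sin_gt_0; lra). nra.
Qed.

Lemma Cmod_cis_minus_le (s t : R) : Cmod (cis s - cis t) <= 2 * Rabs (s - t).
Proof.
  assert (Hlip : forall f f' : R -> R, (forall u, derivable_pt_lim f u (f' u)) ->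
            (forall u, Rabs (f' u) <= 1) -> Rabs (f s - f t) <= Rabs (s - t)).
  { intros f f' Hf Hf'. destruct (MVT_abs f f' t s) as (u & Hu & _); [intros; apply Hf|].
    rewrite Hu. generalize (Hf' u) (Rabs_pos (s - t)). nra. }
  eapply Rle_trans; [apply Cmod_le_Rabs|].
  assert (Hcos := Hlip cos (fun u => - sin u) derivable_pt_lim_cos
                    ltac:(intros; cbv beta; rewrite Rabs_Ropp; apply Rabs_le, SIN_bound)).
  assert (Hsin := Hlip sin cos derivable_pt_lim_sin ltac:(intros; apply Rabs_le, COS_bound)).
  unfold Cminus, Cplus, Copp, cis; cbn [fst snd]. rewrite <- !Rminus_def. lra.
Qed.

Definition character (t : R) (k : Z) : C := cis (IZR k * t).

Lemma character_0 (t : R) : character t 0 = 1.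
Proof. unfold character. rewrite Rmult_0_l. apply cis_0. Qed.

Lemma character_add (t : R) (j k : Z) :
  character t (j + k) = (character t j * character t k)%C.
Proof. unfold character. rewrite <- cis_plus, plus_IZR. f_equal. ring. Qed.

Lemma character_conj (t : R) (k : Z) : Cconj (character t k) = character t (- k).
Proof.
  unfold character, cis, Cconj; cbn [fst snd].
  now rewrite opp_IZR, Ropp_mult_distr_l_reverse, cos_neg, sin_neg.
Qed.

Lemma character_opp (t : R) (k : Z) : character (- t) k = character t (- k).
Proof. unfold character. f_equal. rewrite opp_IZR. ring. Qed.

Lemma Cmod_character (t : R) (k : Z) : Cmod (character t k) = 1.
Proof.
  unfold Cmod, character, cis; cbn [fst snd]. rewrite <- sqrt_1. f_equal.
  generalize (sin2_cos2 (IZR k * t)). unfold Rsqr. lra.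
Qed.

Lemma character_mul_eq_1 (t : R) (n k : Z) : character t n = 1 -> character t (k * n) = 1.
Proof.
  intros Hn. induction k as [|k IH|k IH] using Z.peano_ind.
  - apply character_0.
  - rewrite Z.mul_succ_l, character_add, IH, Hn. ring.
  - replace (character t (Z.pred k * n)) with (character t (Z.pred k * n) * character t n)%C
      by (rewrite Hn; ring).
    rewrite <- character_add, <- IH. f_equal. lia.
Qed.

Lemma character_add_2PI (t : R) (m k : Z) : character (t + IZR m * (2 * PI)) k = character t k.
Proof.
  assert (Hperiod : character (2 * PI) (k * m * 1) = 1).
  { apply character_mul_eq_1. unfold character. rewrite Rmult_1_l. apply cis_2PI. }
  transitivity (character t k * character (2 * PI) (k * m * 1))%C.
  - unfold character. rewrite <- cis_plus, !mult_IZR. f_equal. ring.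
  - rewrite Hperiod. ring.
Qed.

Definition root_angle (N : nat) (j : Z) : R := 2 * PI * IZR j / INR N.

Lemma character_root_angle_N (N : nat) (j : Z) :
  (0 < N)%nat -> character (root_angle N j) (Z.of_nat N) = 1.
Proof.
  intros HN. assert (HN0 : INR N <> 0) by (apply not_0_INR; lia).
  transitivity (character (0 + IZR j * (2 * PI)) 1).
  - unfold character, root_angle. f_equal. rewrite <- INR_IZR_INZ. now field.
  - rewrite character_add_2PI. unfold character. rewrite Rmult_0_r. apply cis_0.
Qed.

Lemma character_root_angle_swap (N : nat) (j k : Z) :
  character (root_angle N j) k = character (root_angle N k) j.
Proof. unfold character, root_angle. f_equal. unfold Rdiv. ring. Qed.

Lemma character_root_angle_neq_1 (N : nat) (j : Z) :
  (0 < Z.abs j < Z.of_nat N)%Z -> character (root_angle N j) 1 <> 1.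
Proof.
  intros Hj. apply cis_neq_1. rewrite Rmult_1_l. unfold root_angle.
  assert (Hj0 : 0 < IZR (Z.abs j)) by (apply IZR_lt; lia).
  assert (HjN : IZR (Z.abs j) < INR N) by (rewrite INR_IZR_INZ; apply IZR_lt; lia).
  assert (HPI := PI_RGT_0).
  unfold Rdiv. rewrite !Rabs_mult, <- (abs_IZR j), Rabs_inv, (Rabs_pos_eq 2), (Rabs_pos_eq PI),
    (Rabs_pos_eq (INR N)) by lra.
  assert (0 < IZR (Z.abs j) / INR N) by (apply Rdiv_lt_0_compat; lra).
  assert (IZR (Z.abs j) / INR N < 1) by (apply Rlt_div_l; lra).
  unfold Rdiv in *. rewrite Rmult_assoc. split; nra.
Qed.

Lemma root_angle_dense (t eps : R) :
  0 < eps -> exists (N : nat) (j : Z), (2 <= N)%nat /\ Rabs (root_angle N j - t) < eps.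
Proof.
  intros Heps. assert (HPI := PI_RGT_0).
  destruct (INR_unbounded (2 * PI / eps)) as [n Hn]. set (N := S (S n)).
  assert (HN : 2 * PI / eps < INR N)
    by (apply Rlt_trans with (1 := Hn), lt_INR; unfold N; lia).
  assert (HN0 : 0 < INR N) by (apply lt_0_INR; unfold N; lia).
  apply Rlt_div_l in HN; [|exact Heps].
  set (x := t * INR N / (2 * PI)). exists N, (Int_part x). split; [unfold N; lia|].
  destruct (base_Int_part x) as [Hle Hgt].
  replace (root_angle N (Int_part x) - t) with ((IZR (Int_part x) - x) * (2 * PI / INR N))
    by (unfold root_angle, x; field; lra).
  assert (Hstep : 0 < 2 * PI / INR N) by (apply Rdiv_lt_0_compat; lra).
  assert (Hstep' : 2 * PI / INR N < eps) by (apply Rlt_div_l; lra).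
  rewrite Rabs_mult, (Rabs_pos_eq (2 * PI / INR N)) by lra.
  assert (Rabs (IZR (Int_part x) - x) <= 1) by (apply Rabs_le; lra).
  generalize (Rabs_pos (IZR (Int_part x) - x)). nra.
Qed.

Lemma csum_character_eq_0 (N : nat) (t : R) :
  character t (Z.of_nat N) = 1 -> character t 1 <> 1 ->
  csum N (fun j => character t (Z.of_nat j)) = 0.
Proof.
  intros HN Ht.
  assert (Geometric : ((character t 1 - 1) * csum N (fun j => character t (Z.of_nat j))
                       = character t (Z.of_nat N) - 1)%C).
  { clear HN. induction N as [|N IH].
    - simpl. rewrite character_0. ring.
    - cbn [csum]. rewrite Nat2Z.inj_succ, <- Z.add_1_r, character_add, Cmult_plus_distr_l, IH.
      ring. }
  rewrite HN in Geometric. apply NNPP. intros Hsum.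
  apply (Cmult_neq_0 _ _ (Cminus_eq_contra _ _ Ht) Hsum). rewrite Geometric. ring.
Qed.

Lemma dft_inversion (N m : nat) (c : nat -> C) :
  (m < N)%nat ->
  csum N (fun j => let t := root_angle N (Z.of_nat j) in
    character t (- Z.of_nat m) * csum N (fun k => c k * character t (Z.of_nat k)))%C
  = (INR N * c m)%C.
Proof.
  intros Hm. cbv zeta.
  rewrite (csum_ext N _ (fun j => csum N (fun k =>
    c k * character (root_angle N (Z.of_nat k - Z.of_nat m)) (Z.of_nat j))%C)).
  2:{ intros j _. rewrite <- csum_scal. apply csum_ext. intros k _.
      rewrite (character_root_angle_swap N (Z.of_nat k - _)).
      unfold Z.sub. rewrite character_add. ring. }
  rewrite csum_swap, (csum_single N m _ Hm).
  - rewrite csum_scal, (csum_ext N _ (fun _ => RtoC 1)), csum_const; [ring|].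
    intros j _. rewrite <- character_root_angle_swap, Z.sub_diag. apply character_0.
  - intros k Hk Hkm. rewrite csum_scal, csum_character_eq_0; [ring| |].
    + apply character_root_angle_N. lia.
    + apply character_root_angle_neq_1. lia.
Qed.

Lemma trig_poly_coef_le (N m : nat) (c : nat -> C) (rho : R) :
  (forall t, Cmod (csum N (fun k => c k * character t (Z.of_nat k))%C) <= rho) ->
  (m < N)%nat -> Cmod (c m) <= rho.
Proof.
  intros Hrho Hm. assert (HN : 0 < INR N) by (apply lt_0_INR; lia).
  apply Rmult_le_reg_l with (INR N); [exact HN|].
  rewrite <- (Rabs_pos_eq (INR N)) at 1 by lra.
  rewrite <- Cmod_R, <- Cmod_mult, <- (dft_inversion N m c Hm).
  apply Cmod_csum_le. intros j _. rewrite Cmod_mult, Cmod_character, Rmult_1_l. apply Hrho.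
Qed.

(** * Bounded two-sided sequences and operators on them *)

Definition seq_zero : Z -> C := fun _ => 0.
Definition seq_plus (x y : Z -> C) : Z -> C := fun i => (x i + y i)%C.
Definition seq_minus (x y : Z -> C) : Z -> C := fun i => (x i - y i)%C.
Definition seq_scal (c : C) (x : Z -> C) : Z -> C := fun i => (c * x i)%C.
Definition seq_shift (k : Z) (x : Z -> C) : Z -> C := fun i => x (i - k)%Z.

Ltac seq_ring :=
  let i := fresh "i" in extensionality i;
  unfold seq_plus, seq_minus, seq_scal, seq_shift, seq_zero; ring.

Definition norm_le (x : Z -> C) (M : R) : Prop := forall i, Cmod (x i) <= M.

Definition is_bounded (x : Z -> C) : Prop := exists M, norm_le x M.

Definition op := (Z -> C) -> Z -> C.

Definition op_plus (T U : op) : op := fun x => seq_plus (T x) (U x).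
Definition op_minus (T U : op) : op := fun x => seq_minus (T x) (U x).
Definition op_scal (c : C) (T : op) : op := fun x => seq_scal c (T x).
Definition op_comp (T U : op) : op := fun x => T (U x).

Definition opnorm_le (T : op) (K : R) : Prop :=
  forall x M, norm_le x M -> norm_le (T x) (K * M).

Lemma norm_le_nonneg (x : Z -> C) (M : R) : norm_le x M -> 0 <= M.
Proof. intros Hx. apply Rle_trans with (2 := Hx 0%Z). apply Cmod_ge_0. Qed.

Lemma norm_le_trans (x : Z -> C) (M M' : R) : norm_le x M -> M <= M' -> norm_le x M'.
Proof. intros Hx HM i. exact (Rle_trans _ _ _ (Hx i) HM). Qed.

Lemma norm_le_plus (x y : Z -> C) (M M' : R) :
  norm_le x M -> norm_le y M' -> norm_le (seq_plus x y) (M + M').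
Proof.
  intros Hx Hy i. eapply Rle_trans; [apply Cmod_triangle|]. now apply Rplus_le_compat.
Qed.

Lemma norm_le_minus (x y : Z -> C) (M M' : R) :
  norm_le x M -> norm_le y M' -> norm_le (seq_minus x y) (M + M').
Proof.
  intros Hx Hy i. eapply Rle_trans; [apply Cmod_minus_le|]. now apply Rplus_le_compat.
Qed.

Lemma norm_le_scal (c : C) (x : Z -> C) (M : R) :
  norm_le x M -> norm_le (seq_scal c x) (Cmod c * M).
Proof.
  intros Hx i. unfold seq_scal. rewrite Cmod_mult.
  apply Rmult_le_compat_l; [apply Cmod_ge_0|apply Hx].
Qed.

Lemma norm_le_character (t : R) : norm_le (character t) 1.
Proof. intros i. rewrite Cmod_character. lra. Qed.

Lemma bounded_zero : is_bounded seq_zero.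
Proof. exists 0. intros i. unfold seq_zero. rewrite Cmod_0. lra. Qed.

Lemma bounded_plus (x y : Z -> C) : is_bounded x -> is_bounded y -> is_bounded (seq_plus x y).
Proof. intros [M Hx] [M' Hy]. exists (M + M'). now apply norm_le_plus. Qed.

Lemma bounded_minus (x y : Z -> C) : is_bounded x -> is_bounded y -> is_bounded (seq_minus x y).
Proof. intros [M Hx] [M' Hy]. exists (M + M'). now apply norm_le_minus. Qed.

Lemma bounded_scal (c : C) (x : Z -> C) : is_bounded x -> is_bounded (seq_scal c x).
Proof. intros [M Hx]. exists (Cmod c * M). now apply norm_le_scal. Qed.

Lemma bounded_shift (k : Z) (x : Z -> C) : is_bounded x -> is_bounded (seq_shift k x).
Proof. intros [M Hx]. exists M. intros i. apply Hx. Qed.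

Lemma bounded_character (t : R) : is_bounded (character t).
Proof. exists 1. apply norm_le_character. Qed.

#[local] Hint Resolve bounded_zero bounded_plus bounded_minus bounded_scal bounded_shift
  bounded_character : bounded.

Lemma seq_shift_character (t : R) (k : Z) :
  seq_shift k (character t) = seq_scal (character t (- k)) (character t).
Proof.
  extensionality i. unfold seq_shift, seq_scal, Z.sub.
  rewrite character_add. ring.
Qed.

(** * Band operators *)

(* Only the band operators with constant diagonals, which commute with each other. *)
Inductive banded (d : nat) : op -> Prop :=
| banded_shift (c : C) (k : Z) :
    (Z.abs k <= Z.of_nat d)%Z -> banded d (fun x => seq_scal c (seq_shift k x))
| banded_plus (T U : op) : banded d T -> banded d U -> banded d (op_plus T U).

Definition symbol (T : op) (t : R) : C := T (character t) 0%Z.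

Lemma banded_ext (d : nat) (T U : op) : (forall x, T x = U x) -> banded d T -> banded d U.
Proof.
  intros E HT. replace U with T; [exact HT|]. now apply functional_extensionality.
Qed.

Lemma banded_le (d d' : nat) (T : op) : (d <= d')%nat -> banded d T -> banded d' T.
Proof.
  intros Hd. induction 1 as [c k Hk|T U _ IT _ IU].
  - apply banded_shift. lia.
  - now apply banded_plus.
Qed.

Lemma banded_id (d : nat) : banded d (fun x => x).
Proof.
  apply (banded_ext d (fun x => seq_scal 1 (seq_shift 0 x))); [|apply banded_shift; lia].
  intros x. extensionality i. unfold seq_scal, seq_shift.
  rewrite Z.sub_0_r. ring.
Qed.

Lemma banded_zero (d : nat) : banded d (fun _ => seq_zero).
Proof.
  apply (banded_ext d (fun x => seq_scal 0 (seq_shift 0 x))); [|apply banded_shift; lia].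
  intros x. seq_ring.
Qed.

Lemma banded_comp (d d' : nat) (T U : op) :
  banded d T -> banded d' U -> banded (d + d') (op_comp T U).
Proof.
  intros HT HU. induction HT as [c k Hk|T1 T2 _ I1 _ I2].
  - induction HU as [c' k' Hk'|U1 U2 _ I1 _ I2].
    + apply (banded_ext _ (fun x => seq_scal (c * c') (seq_shift (k + k') x))).
      * intros x. extensionality i. unfold op_comp, seq_scal, seq_shift.
        rewrite Z.sub_add_distr. ring.
      * apply banded_shift. lia.
    + eapply banded_ext; [|exact (banded_plus _ _ _ I1 I2)]. intros x.
      unfold op_comp, op_plus. seq_ring.
  - exact (banded_plus _ _ _ I1 I2).
Qed.

Lemma banded_scal (d : nat) (c : C) (T : op) : banded d T -> banded d (op_scal c T).
Proof.
  intros HT. apply (banded_ext _ (op_comp (fun x => seq_scal c (seq_shift 0 x)) T)).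
  - intros x. extensionality i. unfold op_comp, op_scal, seq_scal, seq_shift.
    now rewrite Z.sub_0_r.
  - apply (banded_comp 0); [apply banded_shift; lia|exact HT].
Qed.

Lemma banded_iter (d n : nat) (T : op) : banded d T -> banded (n * d) (Nat.iter n T).
Proof.
  intros HT. induction n as [|n IH].
  - apply banded_id.
  - exact (banded_comp _ _ _ _ HT IH).
Qed.

Lemma banded_map_lincomb (d : nat) (T : op) (c : C) (x y : Z -> C) :
  banded d T -> T (seq_plus (seq_scal c x) y) = seq_plus (seq_scal c (T x)) (T y).
Proof.
  induction 1 as [c' k Hk|T U _ IT _ IU].
  - seq_ring.
  - unfold op_plus. rewrite IT, IU. seq_ring.
Qed.

Lemma banded_map_shift (d : nat) (T : op) (k : Z) (x : Z -> C) :
  banded d T -> T (seq_shift k x) = seq_shift k (T x).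
Proof.
  induction 1 as [c k' Hk'|T U _ IT _ IU].
  - extensionality i. unfold seq_scal, seq_shift. do 2 f_equal. ring.
  - unfold op_plus. now rewrite IT, IU.
Qed.

Lemma banded_bounded (d : nat) (T : op) : banded d T -> exists K, 0 <= K /\ opnorm_le T K.
Proof.
  induction 1 as [c k Hk|T U _ (K1 & HK1 & H1) _ (K2 & HK2 & H2)].
  - exists (Cmod c). split; [apply Cmod_ge_0|]. intros x M Hx.
    apply norm_le_scal. intros i. apply Hx.
  - exists (K1 + K2). split; [lra|]. intros x M Hx. rewrite Rmult_plus_distr_r.
    apply norm_le_plus; auto.
Qed.

Lemma banded_symbol_lipschitz (d : nat) (T : op) :
  banded d T ->
  exists K, 0 <= K /\ forall s t, Cmod (symbol T s - symbol T t) <= K * Rabs (s - t).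
Proof.
  unfold symbol. induction 1 as [c k Hk|T U _ (K1 & HK1 & H1) _ (K2 & HK2 & H2)].
  - set (u := Rabs (IZR (0 - k))). assert (Hu : 0 <= u) by apply Rabs_pos.
    exists (Cmod c * (2 * u)). split; [generalize (Cmod_ge_0 c); nra|]. intros s t.
    unfold seq_scal, seq_shift, character.
    replace (c * cis (IZR (0 - k) * s) - c * cis (IZR (0 - k) * t))%C
      with (c * (cis (IZR (0 - k) * s) - cis (IZR (0 - k) * t)))%C by ring.
    rewrite Cmod_mult, Rmult_assoc. apply Rmult_le_compat_l; [apply Cmod_ge_0|].
    eapply Rle_trans; [apply Cmod_cis_minus_le|].
    rewrite <- Rmult_minus_distr_l, Rabs_mult. fold u. lra.
  - exists (K1 + K2). split; [lra|]. intros s t. unfold op_plus, seq_plus.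
    replace (T (character s) 0%Z + U (character s) 0%Z
             - (T (character t) 0%Z + U (character t) 0%Z))%C
      with ((T (character s) 0%Z - T (character t) 0%Z)
            + (U (character s) 0%Z - U (character t) 0%Z))%C by ring.
    eapply Rle_trans; [apply Cmod_triangle|]. generalize (H1 s t) (H2 s t). lra.
Qed.

Lemma banded_coef (d : nat) (T : op) :
  banded d T -> exists c : nat -> C, forall x i,
    T x i = csum (2 * d + 1) (fun k => c k * x (i + Z.of_nat d - Z.of_nat k)%Z)%C.
Proof.
  induction 1 as [c k Hk|T U _ [c1 H1] _ [c2 H2]].
  - exists (fun j => if Nat.eq_dec j (Z.to_nat (k + Z.of_nat d)) then c else 0).
    intros x i. rewrite (csum_single _ (Z.to_nat (k + Z.of_nat d))).
    + destruct (Nat.eq_dec _ _) as [_|]; [|congruence]. unfold seq_scal, seq_shift. do 2 f_equal.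
      rewrite Z2Nat.id by lia. ring.
    + lia.
    + intros j _ Hj. destruct (Nat.eq_dec _ _); [contradiction|ring].
  - exists (fun j => (c1 j + c2 j)%C). intros x i. unfold op_plus, seq_plus.
    rewrite H1, H2, <- csum_plus. apply csum_ext. intros; ring.
Qed.

(* The coefficients of a trigonometric polynomial are bounded by its maximum, and the norm is at
   most the sum of the [2 * d + 1] coefficients. *)
Lemma banded_opnorm_le (d : nat) (T : op) (rho : R) :
  banded d T -> (forall t, Cmod (symbol T t) <= rho) -> opnorm_le T (INR (2 * d + 1) * rho).
Proof.
  intros HT Hrho x M Hx i. destruct (banded_coef d T HT) as [c Hc].
  assert (Hcoef : forall k, (k < 2 * d + 1)%nat -> Cmod (c k) <= rho).
  { intros k. apply trig_poly_coef_le. intros t.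
    replace (csum _ _) with (character t (Z.of_nat d) * symbol T (- t))%C.
    - rewrite Cmod_mult, Cmod_character, Rmult_1_l. apply Hrho.
    - unfold symbol. rewrite Hc, <- csum_scal. apply csum_ext. intros j _.
      rewrite character_opp, Cmult_assoc, (Cmult_comm (character t (Z.of_nat d))), <- Cmult_assoc,
        <- character_add.
      do 2 f_equal. ring. }
  rewrite Hc, Rmult_assoc. apply Cmod_csum_le. intros k Hk. rewrite Cmod_mult.
  apply Rmult_le_compat; try apply Cmod_ge_0; [now apply Hcoef|apply Hx].
Qed.

(* With [S] the shift, this sends the sum of the [c_k S^k] to the sum of the [conj (c_k) S^(-k)]. *)
Definition adjoint (T : op) : op :=
  fun x i => Cconj (T (fun k => Cconj (x (- k)%Z)) (- i)%Z).

Lemma banded_adjoint (d : nat) (T : op) : banded d T -> banded d (adjoint T).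
Proof.
  induction 1 as [c k Hk|T U _ IT _ IU].
  - apply (banded_ext _ (fun x => seq_scal (Cconj c) (seq_shift (- k) x))).
    + intros x. extensionality i. unfold adjoint, seq_scal, seq_shift.
      rewrite Cmult_conj, Cconj_conj. do 2 f_equal. ring.
    + apply banded_shift. lia.
  - eapply banded_ext; [|exact (banded_plus _ _ _ IT IU)].
    intros x. extensionality i. symmetry. apply Cplus_conj.
Qed.

(** * Band-dominated operators *)

(* On unbounded sequences such an operator may take arbitrary values. *)
Definition band_dominated (T : op) : Prop :=
  forall eps, 0 < eps -> exists d P, banded d P /\ opnorm_le (op_minus T P) eps.

Lemma band_dominated_intro (T : op) (K : R) :
  (forall e, 0 < e <= 1 -> exists d P, banded d P /\ opnorm_le (op_minus T P) (K * e)) ->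
  band_dominated T.
Proof.
  intros HT eps Heps. destruct (exists_small_mult_le K eps Heps) as (e & He & HKe).
  destruct (HT e He) as (d & P & HP & HTP). exists d, P. split; [exact HP|].
  intros x M Hx. apply norm_le_trans with (1 := HTP x M Hx).
  apply Rmult_le_compat_r; [exact (norm_le_nonneg x M Hx)|exact HKe].
Qed.

Lemma banded_band_dominated (d : nat) (T : op) : banded d T -> band_dominated T.
Proof.
  intros HT eps Heps. exists d, T. split; [exact HT|]. intros x M Hx i.
  unfold op_minus, seq_minus. replace (T x i - T x i)%C with (RtoC 0) by ring. rewrite Cmod_0.
  generalize (norm_le_nonneg x M Hx). nra.
Qed.

Lemma band_dominated_id : band_dominated (fun x => x).
Proof. exact (banded_band_dominated 0 _ (banded_id 0)). Qed.

Lemma band_dominated_opnorm (T : op) :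
  band_dominated T -> exists K, 0 < K /\ opnorm_le T K.
Proof.
  intros HT. destruct (HT 1 Rlt_0_1) as (d & P & HP & HTP).
  destruct (banded_bounded d P HP) as (K & HK & HPK).
  exists (1 + K). split; [lra|]. intros x M Hx.
  replace (T x) with (seq_plus (op_minus T P x) (P x)) by (unfold op_minus; seq_ring).
  rewrite Rmult_plus_distr_r. apply norm_le_plus; auto.
Qed.

Lemma bounded_image (T : op) (x : Z -> C) : band_dominated T -> is_bounded x -> is_bounded (T x).
Proof.
  intros HT [M Hx]. destruct (band_dominated_opnorm T HT) as (K & _ & HK).
  exists (K * M). now apply HK.
Qed.

#[local] Hint Resolve bounded_image : bounded.

Lemma band_dominated_plus (T U : op) :
  band_dominated T -> band_dominated U -> band_dominated (op_plus T U).
Proof.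
  intros HT HU. apply band_dominated_intro with 2. intros e [He _].
  destruct (HT e He) as (d & P & HP & HTP). destruct (HU e He) as (d' & Q & HQ & HUQ).
  exists (d + d')%nat, (op_plus P Q). split.
  - apply banded_plus; [apply banded_le with d|apply banded_le with d']; auto; lia.
  - intros x M Hx.
    replace (op_minus (op_plus T U) (op_plus P Q) x)
      with (seq_plus (op_minus T P x) (op_minus U Q x)) by (unfold op_minus, op_plus; seq_ring).
    replace (2 * e * M) with (e * M + e * M) by ring. apply norm_le_plus; auto.
Qed.

Lemma band_dominated_scal (c : C) (T : op) : band_dominated T -> band_dominated (op_scal c T).
Proof.
  intros HT. apply band_dominated_intro with (Cmod c). intros e [He _].
  destruct (HT e He) as (d & P & HP & HTP).
  exists d, (op_scal c P). split; [now apply banded_scal|]. intros x M Hx.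
  replace (op_minus (op_scal c T) (op_scal c P) x) with (seq_scal c (op_minus T P x))
    by (unfold op_minus, op_scal; seq_ring).
  rewrite Rmult_assoc. apply norm_le_scal; auto.
Qed.

Lemma band_dominated_minus (T U : op) :
  band_dominated T -> band_dominated U -> band_dominated (op_minus T U).
Proof.
  intros HT HU. replace (op_minus T U) with (op_plus T (op_scal (- (1)) U)).
  - now apply band_dominated_plus; [|apply band_dominated_scal].
  - extensionality x. unfold op_plus, op_minus, op_scal. seq_ring.
Qed.

Lemma band_dominated_comp (T U : op) :
  band_dominated T -> band_dominated U -> band_dominated (op_comp T U).
Proof.
  intros HT HU.
  destruct (band_dominated_opnorm T HT) as (KT & HKT & HT').
  destruct (band_dominated_opnorm U HU) as (KU & HKU & HU').
  apply band_dominated_intro with (KU + (1 + KT)). intros e He.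
  destruct (HT e (proj1 He)) as (d & P & HP & HTP).
  destruct (HU e (proj1 He)) as (d' & Q & HQ & HUQ).
  assert (HP' : opnorm_le P (1 + KT)).
  { intros x M Hx. assert (HM := norm_le_nonneg x M Hx).
    replace (P x) with (seq_minus (T x) (op_minus T P x)) by (unfold op_minus; seq_ring).
    apply norm_le_trans with (KT * M + e * M); [apply norm_le_minus; auto|nra]. }
  exists (d + d')%nat, (op_comp P Q). split; [now apply banded_comp|]. intros x M Hx.
  replace (op_minus (op_comp T U) (op_comp P Q) x)
    with (seq_plus (op_minus T P (U x)) (P (op_minus U Q x))).
  - replace ((KU + (1 + KT)) * e * M) with (e * (KU * M) + (1 + KT) * (e * M)) by ring.
    apply norm_le_plus; auto.
  - replace (op_minus U Q x) with (seq_plus (seq_scal (- (1)) (Q x)) (U x))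
      by (unfold op_minus; seq_ring).
    rewrite (banded_map_lincomb d P) by exact HP. unfold op_minus, op_comp. seq_ring.
Qed.

Lemma band_dominated_adjoint (T : op) : band_dominated T -> band_dominated (adjoint T).
Proof.
  intros HT eps Heps. destruct (HT eps Heps) as (d & P & HP & HTP).
  exists d, (adjoint P). split; [now apply banded_adjoint|]. intros x M Hx i.
  unfold op_minus, seq_minus, adjoint. rewrite <- Cminus_conj, Cmod_conj.
  apply (HTP (fun k => Cconj (x (- k)%Z))). intros k. rewrite Cmod_conj. apply Hx.
Qed.

Lemma band_dominated_map_lincomb (T : op) (c : C) (x y : Z -> C) :
  band_dominated T -> is_bounded x -> is_bounded y ->
  T (seq_plus (seq_scal c x) y) = seq_plus (seq_scal c (T x)) (T y).
Proof.
  intros HT [Mx Hx] [My Hy]. set (z := seq_plus (seq_scal c x) y).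
  assert (Hz : norm_le z (Cmod c * Mx + My)) by (apply norm_le_plus; [now apply norm_le_scal|auto]).
  extensionality i.
  apply Ceq_of_Cmod_le_small_mult with (Cmod c * Mx + My + (Cmod c * Mx + My)).
  intros e [He _]. destruct (HT e He) as (d & P & HP & HTP).
  set (E := op_minus T P) in HTP.
  replace (T z i - seq_plus (seq_scal c (T x)) (T y) i)%C
    with (seq_minus (E z) (seq_plus (seq_scal c (E x)) (E y)) i).
  - apply norm_le_trans with (e * (Cmod c * Mx + My) + (Cmod c * (e * Mx) + e * My)); [|lra].
    apply norm_le_minus; [now apply HTP|].
    apply norm_le_plus; [now apply norm_le_scal, HTP|now apply HTP].
  - unfold E, op_minus, z. rewrite (banded_map_lincomb d P) by exact HP.
    unfold seq_minus, seq_plus, seq_scal. ring.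
Qed.

Lemma band_dominated_map_zero (T : op) : band_dominated T -> T seq_zero = seq_zero.
Proof.
  intros HT. replace seq_zero with (seq_plus (seq_scal (- (1)) seq_zero) seq_zero) at 1 by seq_ring.
  rewrite band_dominated_map_lincomb by auto with bounded. seq_ring.
Qed.

Lemma band_dominated_map_plus (T : op) (x y : Z -> C) :
  band_dominated T -> is_bounded x -> is_bounded y -> T (seq_plus x y) = seq_plus (T x) (T y).
Proof.
  intros HT Hx Hy. replace (seq_plus x y) with (seq_plus (seq_scal 1 x) y) by seq_ring.
  rewrite band_dominated_map_lincomb by assumption. seq_ring.
Qed.

Lemma band_dominated_map_scal (T : op) (c : C) (x : Z -> C) :
  band_dominated T -> is_bounded x -> T (seq_scal c x) = seq_scal c (T x).
Proof.
  intros HT Hx. replace (seq_scal c x) with (seq_plus (seq_scal c x) seq_zero) by seq_ring.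
  rewrite band_dominated_map_lincomb, band_dominated_map_zero by auto with bounded. seq_ring.
Qed.

Lemma band_dominated_map_minus (T : op) (x y : Z -> C) :
  band_dominated T -> is_bounded x -> is_bounded y -> T (seq_minus x y) = seq_minus (T x) (T y).
Proof.
  intros HT Hx Hy. replace (seq_minus x y) with (seq_plus (seq_scal (- (1)) y) x) by seq_ring.
  rewrite band_dominated_map_lincomb by assumption. seq_ring.
Qed.

Lemma band_dominated_map_shift (T : op) (k : Z) (x : Z -> C) :
  band_dominated T -> is_bounded x -> T (seq_shift k x) = seq_shift k (T x).
Proof.
  intros HT [M Hx]. assert (Hxk : norm_le (seq_shift k x) M) by (intros i; apply Hx).
  extensionality i.
  apply Ceq_of_Cmod_le_small_mult with (M + M). intros e [He _].
  destruct (HT e He) as (d & P & HP & HTP). set (E := op_minus T P) in HTP.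
  replace (T (seq_shift k x) i - seq_shift k (T x) i)%C
    with (seq_minus (E (seq_shift k x)) (seq_shift k (E x)) i).
  - apply norm_le_trans with (e * M + e * M); [|lra].
    apply norm_le_minus; [now apply HTP|intros j; now apply HTP].
  - unfold E, op_minus. rewrite (banded_map_shift d P) by exact HP.
    unfold seq_minus, seq_shift. ring.
Qed.

Lemma band_dominated_banded_comm (d : nat) (T P : op) (x : Z -> C) :
  band_dominated T -> banded d P -> is_bounded x -> T (P x) = P (T x).
Proof.
  intros HT HP Hx. induction HP as [c k Hk|P Q HP IP HQ IQ].
  - rewrite band_dominated_map_scal, band_dominated_map_shift by auto with bounded. reflexivity.
  - assert (HP' := banded_band_dominated d P HP). assert (HQ' := banded_band_dominated d Q HQ).
    unfold op_plus. rewrite band_dominated_map_plus, IP, IQ by auto with bounded. reflexivity.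
Qed.

Lemma band_dominated_comm (T U : op) (x : Z -> C) :
  band_dominated T -> band_dominated U -> is_bounded x -> T (U x) = U (T x).
Proof.
  intros HT HU [M Hx]. assert (Hx' : is_bounded x) by (now exists M).
  destruct (band_dominated_opnorm T HT) as (K & HK & HT').
  extensionality i.
  apply Ceq_of_Cmod_le_small_mult with (K * M + K * M). intros e [He _].
  destruct (HU e He) as (d & P & HP & HUP).
  assert (HP' := banded_band_dominated d P HP). set (E := op_minus U P) in HUP.
  replace (T (U x) i - U (T x) i)%C with (seq_minus (T (E x)) (E (T x)) i).
  - apply norm_le_trans with (K * (e * M) + e * (K * M)); [|lra].
    apply norm_le_minus; [apply HT'; now apply HUP|apply HUP; now apply HT'].
  - unfold E, op_minus. rewrite (band_dominated_map_minus T) by auto with bounded.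
    rewrite (band_dominated_banded_comm d T P) by assumption. unfold seq_minus. ring.
Qed.

Lemma band_dominated_map_character (T : op) (t : R) :
  band_dominated T -> T (character t) = seq_scal (symbol T t) (character t).
Proof.
  intros HT. extensionality i.
  transitivity (seq_shift (- i) (T (character t)) 0%Z).
  - unfold seq_shift. f_equal. ring.
  - rewrite <- band_dominated_map_shift, seq_shift_character, band_dominated_map_scal
      by auto with bounded.
    unfold seq_scal, symbol. rewrite Z.opp_involutive. ring.
Qed.

Lemma symbol_comp (T U : op) (t : R) :
  band_dominated T -> band_dominated U ->
  symbol (op_comp T U) t = (symbol T t * symbol U t)%C.
Proof.
  intros HT HU. unfold symbol at 1, op_comp.
  rewrite (band_dominated_map_character U), band_dominated_map_scal by auto with bounded.
  unfold seq_scal, symbol. ring.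
Qed.

Lemma symbol_adjoint (T : op) (t : R) : symbol (adjoint T) t = Cconj (symbol T t).
Proof.
  unfold symbol, adjoint. do 2 f_equal. extensionality k.
  rewrite character_conj. f_equal. ring.
Qed.

Lemma symbol_comp_scal_adjoint (T : op) (r t : R) :
  band_dominated T ->
  symbol (op_comp T (op_scal r (adjoint T))) t = RtoC (r * Cmod (symbol T t) ^ 2).
Proof.
  intros HT. rewrite symbol_comp by auto using band_dominated_scal, band_dominated_adjoint.
  change (symbol (op_scal r (adjoint T)) t) with (r * symbol (adjoint T) t)%C.
  rewrite symbol_adjoint, RtoC_mult, Cmod2_conj. ring.
Qed.

Lemma symbol_iter (d n : nat) (T : op) (t : R) :
  banded d T -> symbol (Nat.iter n T) t = (symbol T t ^ n)%C.
Proof.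
  intros HT. induction n as [|n IH].
  - apply character_0.
  - rewrite Cpow_S, <- IH. apply (symbol_comp T (Nat.iter n T));
      eapply banded_band_dominated; eauto using banded_iter.
Qed.

Lemma Cmod_symbol_le (T : op) (K t : R) : opnorm_le T K -> Cmod (symbol T t) <= K.
Proof. intros HT. rewrite <- (Rmult_1_r K). apply HT, norm_le_character. Qed.

Lemma symbol_add_2PI (T : op) (t : R) (m : Z) : symbol T (t + IZR m * (2 * PI)) = symbol T t.
Proof.
  unfold symbol. f_equal. extensionality k. apply character_add_2PI.
Qed.

Lemma Cmod_symbol_continuous (T : op) (t : R) :
  band_dominated T -> continuity_pt (fun s => Cmod (symbol T s)) t.
Proof.
  intros HT eps Heps. destruct (HT (eps / 4)) as (d & P & HP & HTP); [lra|].
  destruct (banded_symbol_lipschitz d P HP) as (K & HK & HPK).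
  destruct (exists_small_mult_le K (eps / 4)) as (e & He & HKe); [lra|].
  exists e. split; [apply He|]. intros s [_ Hst]. simpl in *. unfold Rdist in *.
  assert (Hs := Cmod_symbol_le _ _ s HTP). assert (Ht := Cmod_symbol_le _ _ t HTP).
  unfold symbol, op_minus, seq_minus in Hs, Ht. fold (symbol T s) (symbol P s) in Hs.
  fold (symbol T t) (symbol P t) in Ht.
  assert (HP' : Cmod (symbol P s - symbol P t) <= eps / 4)
    by (generalize (HPK s t) (Rabs_pos (s - t)); nra).
  apply Rle_lt_trans with (1 := Rabs_Cmod_minus_le _ _).
  generalize (Cmod_dist_triangle (symbol T s) (symbol P s) (symbol T t))
             (Cmod_dist_triangle (symbol P s) (symbol P t) (symbol T t)).
  rewrite (Cmod_minus_sym (symbol P t)). lra.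
Qed.

Lemma symbol_bounded_below (T : op) :
  band_dominated T -> (forall t, symbol T t <> 0) ->
  exists c, 0 < c /\ forall t, c <= Cmod (symbol T t).
Proof.
  intros HT Hnz. assert (HPI := PI_RGT_0).
  destruct (continuity_ab_min (fun t => Cmod (symbol T t)) 0 (2 * PI)) as (t0 & Hmin & _).
  { lra. }
  { intros t _. now apply Cmod_symbol_continuous. }
  exists (Cmod (symbol T t0)). split; [now apply Cmod_gt_0, Hnz|]. intros t.
  set (m := Int_part (t / (2 * PI))).
  rewrite <- (symbol_add_2PI T t (- m)). apply Hmin.
  destruct (base_Int_part (t / (2 * PI))) as [Hle Hgt]. fold m in Hle, Hgt.
  replace (t + IZR (- m) * (2 * PI)) with ((t / (2 * PI) - IZR m) * (2 * PI))
    by (rewrite opp_IZR; field; lra).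
  split; nra.
Qed.

(** * Series of complex numbers *)

Definition cseries (a : nat -> C) : C :=
  (Series (fun n => fst (a n)), Series (fun n => snd (a n))).

Lemma ex_series_dominated (a b : nat -> R) :
  (forall n, Rabs (a n) <= b n) -> ex_series b -> ex_series a.
Proof. exact (ex_series_le (V := R_CompleteNormedModule) a b). Qed.

Lemma ex_series_fst (a : nat -> C) (b : nat -> R) :
  (forall n, Cmod (a n) <= b n) -> ex_series b -> ex_series (fun n => fst (a n)).
Proof.
  intros Hab. apply ex_series_dominated. intros n.
  apply Rle_trans with (2 := Hab n), Rabs_fst_le_Cmod.
Qed.

Lemma ex_series_snd (a : nat -> C) (b : nat -> R) :
  (forall n, Cmod (a n) <= b n) -> ex_series b -> ex_series (fun n => snd (a n)).
Proof.
  intros Hab. apply ex_series_dominated. intros n.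
  apply Rle_trans with (2 := Hab n), Rabs_snd_le_Cmod.
Qed.

Lemma Rabs_Series_le (a b : nat -> R) :
  (forall n, Rabs (a n) <= b n) -> ex_series b -> Rabs (Series a) <= Series b.
Proof.
  intros Hab Hb. eapply Rle_trans.
  - apply Series_Rabs, ex_series_dominated with b; [|exact Hb].
    intros n. rewrite Rabs_Rabsolu. apply Hab.
  - apply Series_le; [|exact Hb]. intros n. split; [apply Rabs_pos|apply Hab].
Qed.

Lemma Cmod_cseries_le (a : nat -> C) (b : nat -> R) :
  (forall n, Cmod (a n) <= b n) -> ex_series b -> Cmod (cseries a) <= 2 * Series b.
Proof.
  intros Hab Hb. eapply Rle_trans; [apply Cmod_le_Rabs|].
  assert (Rabs (fst (cseries a)) <= Series b).
  { apply Rabs_Series_le; [|exact Hb]. intros n.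
    apply Rle_trans with (2 := Hab n), Rabs_fst_le_Cmod. }
  assert (Rabs (snd (cseries a)) <= Series b).
  { apply Rabs_Series_le; [|exact Hb]. intros n.
    apply Rle_trans with (2 := Hab n), Rabs_snd_le_Cmod. }
  lra.
Qed.

Lemma cseries_incr_n (a : nat -> C) (b : nat -> R) (n : nat) :
  (forall k, Cmod (a k) <= b k) -> ex_series b ->
  cseries a = (csum n a + cseries (fun k => a (n + k)%nat))%C.
Proof.
  intros Hab Hb. induction n as [|n IH].
  - simpl. rewrite Cplus_0_l. reflexivity.
  - rewrite IH. cbn [csum]. rewrite <- Cplus_assoc. f_equal. unfold cseries.
    rewrite (Series_incr_1 (fun k => fst (a (n + k)%nat))).
    2:{ apply (ex_series_incr_n (fun k => fst (a k))). now apply ex_series_fst with b. }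
    rewrite (Series_incr_1 (fun k => snd (a (n + k)%nat))).
    2:{ apply (ex_series_incr_n (fun k => snd (a k))). now apply ex_series_snd with b. }
    rewrite Nat.add_0_r. unfold Cplus; cbn [fst snd].
    do 2 f_equal; apply Series_ext; intros k; now rewrite Nat.add_succ_r.
Qed.

Lemma Cmod_cseries_minus_csum_le (a : nat -> C) (b : nat -> R) (n : nat) :
  (forall k, Cmod (a k) <= b k) -> ex_series b ->
  Cmod (cseries a - csum n a) <= 2 * Series (fun k => b (n + k)%nat).
Proof.
  intros Hab Hb. rewrite (cseries_incr_n a b n Hab Hb).
  replace (csum n a + cseries (fun k => a (n + k)%nat) - csum n a)%C
    with (cseries (fun k => a (n + k)%nat)) by ring.
  apply Cmod_cseries_le; [intros; apply Hab|]. now apply (ex_series_incr_n b).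
Qed.

Lemma is_series_geometric_tail (K s : R) (n : nat) :
  0 <= s < 1 -> is_series (fun k => K * s ^ (n + k)) (K * s ^ n / (1 - s)).
Proof.
  intros Hs.
  assert (Hgeom := is_series_scal_l (K * s ^ n) _ _
                     (is_series_geom s ltac:(rewrite Rabs_pos_eq; lra))).
  eapply is_series_ext; [|exact Hgeom]. intros k. rewrite pow_add.
  unfold scal; simpl; unfold mult; simpl. ring.
Qed.

(** * Wiener's lemma *)

Definition bijective_on_bounded (T : op) : Prop :=
  forall y, is_bounded y -> exists! x, is_bounded x /\ T x = y.

(* The factors [B = P + (B - P)] are expanded one at a time.  The powers of [P] that occur have
   width at most [N * d], so the factor [2 * (N * d) + 1] is paid only once. *)
Lemma opnorm_le_mixed_iter (B P : op) (d m n N : nat) (rho eta : R) :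
  band_dominated B -> banded d P -> 0 <= rho ->
  opnorm_le (op_minus B P) eta -> (forall t, Cmod (symbol P t) <= rho) -> (m + n <= N)%nat ->
  opnorm_le (op_comp (Nat.iter m P) (Nat.iter n B))
            (INR (2 * (N * d) + 1) * (rho ^ m * (rho + eta) ^ n)).
Proof.
  intros HB HP Hrho HBP Hsymbol. revert m.
  induction n as [|n IH]; intros m Hmn x M Hx.
  - assert (HM := norm_le_nonneg x M Hx). assert (Hpow := pow_le rho m Hrho).
    apply norm_le_trans with (INR (2 * (m * d) + 1) * rho ^ m * M).
    + apply (banded_opnorm_le _ (Nat.iter m P)); [now apply banded_iter| |exact Hx]. intros t.
      rewrite (symbol_iter d), Cmod_pow by exact HP. apply pow_incr.
      split; [apply Cmod_ge_0|apply Hsymbol].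
    + rewrite pow_O, Rmult_1_r. apply Rmult_le_compat_r; [exact HM|].
      apply Rmult_le_compat_r; [exact Hpow|]. apply le_INR. nia.
  - set (K := INR (2 * (N * d) + 1)). set (y := Nat.iter n B x).
    assert (Hy : is_bounded y) by (eexists; exact (IH 0%nat ltac:(lia) x M Hx)).
    assert (Hz : norm_le (Nat.iter m P y) (K * (rho ^ m * (rho + eta) ^ n) * M))
      by (now apply IH; [lia|]).
    assert (HPz : norm_le (P (Nat.iter m P y)) (K * (rho ^ S m * (rho + eta) ^ n) * M))
      by (now apply (IH (S m)); [lia|]).
    assert (Hsplit : op_comp (Nat.iter m P) (Nat.iter (S n) B) x
                     = seq_plus (P (Nat.iter m P y)) (op_minus B P (Nat.iter m P y))).
    { assert (HPm := banded_band_dominated _ _ (banded_iter d m P HP)).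
      transitivity (B (Nat.iter m P y)); [|unfold op_minus; seq_ring].
      exact (band_dominated_comm _ B y HPm HB Hy). }
    rewrite Hsplit.
    replace (K * (rho ^ m * (rho + eta) ^ S n) * M)
      with (K * (rho ^ S m * (rho + eta) ^ n) * M + eta * (K * (rho ^ m * (rho + eta) ^ n) * M))
      by (simpl; ring).
    apply norm_le_plus; [exact HPz|now apply HBP].
Qed.

(* The norm of the n-th power of a band operator exceeds the supremum of its symbol by a factor
   that is only linear in n, so the symbol controls the spectral radius. *)
Lemma opnorm_le_iter_geometric (B : op) (rho r : R) :
  band_dominated B -> (forall t, Cmod (symbol B t) <= rho) -> rho < r ->
  exists K, forall n, opnorm_le (Nat.iter n B) (K * r ^ n).
Proof.
  intros HB Hrho Hr. set (eta := (r - rho) / 3). assert (Heta : 0 < eta) by (unfold eta; lra).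
  assert (Hrho0 : 0 <= rho) by (apply Rle_trans with (2 := Hrho 0); apply Cmod_ge_0).
  destruct (HB eta Heta) as (d & P & HP & HBP).
  assert (HPsymbol : forall t, Cmod (symbol P t) <= rho + eta).
  { intros t. assert (Hdiff := Cmod_symbol_le _ _ t HBP).
    replace (symbol P t) with (symbol B t - symbol (op_minus B P) t)%C
      by (unfold symbol, op_minus, seq_minus; ring).
    generalize (Cmod_minus_le (symbol B t) (symbol (op_minus B P) t)) (Hrho t). lra. }
  destruct (affine_mult_pow_le (2 * INR d) 1 (rho + eta + eta) r) as [K HK].
  { generalize (pos_INR d). lra. }
  { lra. }
  { unfold eta in *. lra. }
  exists K. intros n x M Hx.
  assert (Hmixed : norm_le (Nat.iter n B x)
            (INR (2 * (n * d) + 1) * ((rho + eta) ^ 0 * (rho + eta + eta) ^ n) * M))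
    by (apply (opnorm_le_mixed_iter B P d 0 n n); auto; lra).
  apply norm_le_trans with (1 := Hmixed).
  apply Rmult_le_compat_r; [exact (norm_le_nonneg x M Hx)|].
  apply Rle_trans with (2 := HK n). right.
  rewrite plus_INR, !mult_INR. simpl. ring.
Qed.

Lemma neumann_trivial_kernel (B : op) (K s : R) (x : Z -> C) :
  0 <= s < 1 -> (forall n, opnorm_le (Nat.iter n B) (K * s ^ n)) ->
  is_bounded x -> B x = x -> x = seq_zero.
Proof.
  intros Hs HK [M Hx] HBx.
  assert (Hiter : forall n, Nat.iter n B x = x).
  { induction n as [|n IH]; [reflexivity|]. simpl. now rewrite IH. }
  extensionality i. apply Cmod_eq_0, Rle_antisym; [|apply Cmod_ge_0].
  apply (nonpos_of_le_geometric (K * M) s _ Hs). intros n.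
  generalize (HK n x M Hx i). rewrite Hiter. lra.
Qed.

Definition neumann_sum (B : op) (y : Z -> C) : Z -> C :=
  fun i => cseries (fun n => Nat.iter n B y i).

Definition neumann_partial_sum (B : op) (y : Z -> C) (n : nat) : Z -> C :=
  fun i => csum n (fun k => Nat.iter k B y i).

Lemma neumann_remainder_le (B : op) (K s : R) (y : Z -> C) (M : R) (n : nat) :
  0 <= s < 1 -> (forall k, opnorm_le (Nat.iter k B) (K * s ^ k)) -> norm_le y M ->
  norm_le (seq_minus (neumann_sum B y) (neumann_partial_sum B y n))
          (2 * (K * M / (1 - s)) * s ^ n).
Proof.
  intros Hs HK Hy i. eapply Rle_trans.
  - apply (Cmod_cseries_minus_csum_le _ (fun k => K * M * s ^ k)).
    + intros k. generalize (HK k y M Hy i). lra.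
    + eexists. exact (is_series_geometric_tail (K * M) s 0 Hs).
  - rewrite (is_series_unique _ _ (is_series_geometric_tail (K * M) s n Hs)).
    right. field. lra.
Qed.

Lemma bounded_iter (B : op) (y : Z -> C) (n : nat) :
  band_dominated B -> is_bounded y -> is_bounded (Nat.iter n B y).
Proof. intros HB Hy. induction n as [|n IH]; [exact Hy|]. exact (bounded_image B _ HB IH). Qed.

Lemma bounded_neumann_partial_sum (B : op) (y : Z -> C) (n : nat) :
  band_dominated B -> is_bounded y -> is_bounded (neumann_partial_sum B y n).
Proof.
  intros HB Hy. induction n as [|n IH]; [exact bounded_zero|].
  apply (bounded_plus _ (Nat.iter n B y)); [exact IH|now apply bounded_iter].
Qed.

Lemma band_dominated_neumann_partial_sum (B : op) (y : Z -> C) (n : nat) :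
  band_dominated B -> is_bounded y ->
  B (neumann_partial_sum B y n) = seq_minus (neumann_partial_sum B y (S n)) y.
Proof.
  intros HB Hy. induction n as [|n IH].
  - transitivity seq_zero; [exact (band_dominated_map_zero B HB)|].
    unfold neumann_partial_sum, csum. simpl. seq_ring.
  - transitivity (seq_plus (B (neumann_partial_sum B y n)) (Nat.iter (S n) B y)).
    + exact (band_dominated_map_plus B _ _ HB (bounded_neumann_partial_sum B y n HB Hy)
               (bounded_iter B y n HB Hy)).
    + rewrite IH. unfold neumann_partial_sum. cbn [csum]. seq_ring.
Qed.

Lemma neumann_surjective (B : op) (K s : R) (y : Z -> C) :
  band_dominated B -> 0 <= s < 1 -> (forall n, opnorm_le (Nat.iter n B) (K * s ^ n)) ->
  is_bounded y -> exists x, is_bounded x /\ seq_minus x (B x) = y.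
Proof.
  intros HB Hs HK Hy. assert (Hpartial := fun n => bounded_neumann_partial_sum B y n HB Hy).
  destruct Hy as [M Hy]. assert (Hremainder := fun n => neumann_remainder_le B K s y M n Hs HK Hy).
  destruct (band_dominated_opnorm B HB) as (KB & HKB & HB').
  set (x := neumann_sum B y) in *. set (partial := neumann_partial_sum B y) in *.
  set (E := 2 * (K * M / (1 - s))) in *.
  assert (Hx : is_bounded x).
  { replace x with (seq_plus (seq_minus x (partial O)) (partial O)) by seq_ring.
    apply bounded_plus; [eexists; exact (Hremainder O)|apply Hpartial]. }
  exists x. split; [exact Hx|]. extensionality i.
  apply Ceq_minus, Cmod_eq_0, Rle_antisym; [|apply Cmod_ge_0].
  apply (nonpos_of_le_geometric (E * s + KB * E) s _ Hs). intros n.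
  replace (seq_minus x (B x) i - y i)%C
    with (seq_minus (seq_minus x (partial (S n))) (B (seq_minus x (partial n))) i).
  - apply norm_le_trans with (E * s ^ S n + KB * (E * s ^ n)); [|simpl; lra].
    apply norm_le_minus; [apply Hremainder|apply HB', Hremainder].
  - rewrite band_dominated_map_minus by auto. unfold partial.
    rewrite band_dominated_neumann_partial_sum by (auto; now exists M).
    unfold seq_minus. ring.
Qed.

Lemma neumann_bijective_on_bounded (B : op) (K s : R) :
  band_dominated B -> 0 <= s < 1 -> (forall n, opnorm_le (Nat.iter n B) (K * s ^ n)) ->
  bijective_on_bounded (op_minus (fun x => x) B).
Proof.
  intros HB Hs HK y Hy. destruct (neumann_surjective B K s y HB Hs HK Hy) as (x & Hx & Ex).
  exists x. split; [now split|]. intros x' [Hx' Ex'].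
  assert (Hzero : seq_minus x x' = seq_zero).
  { apply (neumann_trivial_kernel B K s); auto with bounded.
    rewrite band_dominated_map_minus by assumption. extensionality i.
    assert (Exi : (x i - B x i)%C = y i) by (now rewrite <- Ex).
    assert (Exi' : (x' i - B x' i)%C = y i) by (now rewrite <- Ex').
    unfold seq_minus. apply Ceq_minus.
    replace (B x i - B x' i - (x i - x' i))%C with ((x' i - B x' i) - (x i - B x i))%C by ring.
    rewrite Exi, Exi'. ring. }
  extensionality i. apply Ceq_minus.
  exact (f_equal (fun z => z i) Hzero).
Qed.

Lemma bijective_of_bijective_comp (T U : op) :
  band_dominated T -> band_dominated U ->
  bijective_on_bounded (op_comp T U) -> bijective_on_bounded T.
Proof.
  intros HT HU HTU y Hy. destruct (HTU y Hy) as (u & [Hu Eu] & _).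
  exists (U u). split; [split; [auto with bounded|exact Eu]|]. intros x [Hx Ex].
  destruct (HTU (U y)) as (z & _ & Hunique); [auto with bounded|].
  rewrite <- (Hunique (U u)), <- (Hunique x); [reflexivity| |]; split; auto with bounded.
  - unfold op_comp. rewrite band_dominated_comm by assumption. now rewrite Ex.
  - unfold op_comp. rewrite band_dominated_comm by auto with bounded. now f_equal.
Qed.

(* If [c <= |symbol T| <= K], then the symbol of [1 - T T* / K^2] takes values in
   [[0, 1 - c^2 / K^2]], so that [T T*] is inverted by a Neumann series. *)
Lemma wiener_bijective_on_bounded (T : op) :
  band_dominated T -> (forall t, symbol T t <> 0) -> bijective_on_bounded T.
Proof.
  intros HT Hnz.
  destruct (symbol_bounded_below T HT Hnz) as (c & Hc & Hlow).
  destruct (band_dominated_opnorm T HT) as (K & HK & HTK).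
  set (U := op_scal (RtoC (/ (K * K))) (adjoint T)).
  assert (HU : band_dominated U) by (now apply band_dominated_scal, band_dominated_adjoint).
  apply (bijective_of_bijective_comp T U HT HU).
  set (B := op_minus (fun x => x) (op_comp T U)).
  assert (HB : band_dominated B)
    by (apply band_dominated_minus; [apply band_dominated_id|now apply band_dominated_comp]).
  assert (HcK : 0 < c / K <= 1).
  { split; [now apply Rdiv_lt_0_compat|]. apply Rle_div_l; [exact HK|].
    rewrite Rmult_1_l. exact (Rle_trans _ _ _ (Hlow 0) (Cmod_symbol_le T K 0 HTK)). }
  assert (Hsymbol : forall t, Cmod (symbol B t) <= 1 - (c / K) ^ 2).
  { intros t. replace (symbol B t) with (RtoC (1 - (Cmod (symbol T t) / K) ^ 2)).
    - assert (Hratio : c / K <= Cmod (symbol T t) / K <= 1).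
      { split; [apply Rmult_le_compat_r; [now apply Rlt_le, Rinv_0_lt_compat|apply Hlow]|].
        apply Rle_div_l; [exact HK|]. rewrite Rmult_1_l. now apply Cmod_symbol_le. }
      rewrite Cmod_R, Rabs_pos_eq; nra.
    - change (symbol B t) with (character t 0 - symbol (op_comp T U) t)%C.
      unfold U. rewrite symbol_comp_scal_adjoint, character_0, <- RtoC_minus by exact HT.
      f_equal. field. lra. }
  destruct (opnorm_le_iter_geometric B _ (1 - (c / K) ^ 2 / 2) HB Hsymbol) as [Q HQ]; [nra|].
  replace (op_comp T U) with (op_minus (fun x => x) B).
  - apply neumann_bijective_on_bounded with Q (1 - (c / K) ^ 2 / 2); [exact HB|nra|exact HQ].
  - extensionality x. unfold B, op_minus. seq_ring.
Qed.

(** * Absolutely convergent sums over the integers *)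

Definition Zsummable (g : Z -> R) : Prop :=
  ex_series (fun n => g (Z.of_nat n)) /\ ex_series (fun n => g (- Z.of_nat (S n))%Z).

Lemma Zsummable_dominated (g b : Z -> R) :
  (forall k, Rabs (g k) <= b k) -> Zsummable b -> Zsummable g.
Proof.
  intros Hg [Hpos Hneg].
  split; [apply ex_series_dominated with (2 := Hpos)|apply ex_series_dominated with (2 := Hneg)];
    intros; apply Hg.
Qed.

Lemma Zsummable_scal_r (g : Z -> R) (c : R) : Zsummable g -> Zsummable (fun k => g k * c).
Proof. intros [Hpos Hneg]. split; now apply ex_series_scal_r. Qed.

Lemma Zsum_lincomb (a b : R) (u v : Z -> R) :
  Zsummable u -> Zsummable v ->
  Zsum (fun k => a * u k + b * v k) = a * Zsum u + b * Zsum v.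
Proof.
  intros [Hu Hu'] [Hv Hv']. unfold Zsum.
  rewrite !Series_plus, !Series_scal_l by (apply (ex_series_scal_l (V := R_NormedModule)); auto).
  ring.
Qed.

Lemma Zsummable_opp (g : Z -> R) : Zsummable g -> Zsummable (fun k => g (- k)%Z).
Proof.
  intros [Hpos Hneg]. split.
  - now apply (ex_series_incr_1 (fun n => g (- Z.of_nat n)%Z)).
  - apply (ex_series_incr_1 (fun n => g (Z.of_nat n))) in Hpos.
    eapply ex_series_ext; [|exact Hpos]. intros n. simpl. f_equal.
Qed.

Lemma Zsum_opp (g : Z -> R) : Zsummable g -> Zsum (fun k => g (- k)%Z) = Zsum g.
Proof.
  intros Hg. destruct (Zsummable_opp g Hg) as [Hpos' _]. destruct Hg as [Hpos _]. unfold Zsum.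
  rewrite (Series_incr_1 _ Hpos'), (Series_incr_1 _ Hpos).
  rewrite (Series_ext (fun n => g (- - Z.of_nat (S n))%Z) (fun n => g (Z.of_nat (S n))))
    by (intros; now rewrite Z.opp_involutive).
  simpl. ring.
Qed.

Lemma Zsummable_succ (g : Z -> R) : Zsummable g -> Zsummable (fun k => g (Z.succ k)).
Proof.
  intros [Hpos Hneg]. split.
  - apply (ex_series_incr_1 (fun n => g (Z.of_nat n))) in Hpos.
    eapply ex_series_ext; [|exact Hpos]. intros n. cbv beta. f_equal. lia.
  - apply (ex_series_incr_1 (fun n => g (Z.succ (- Z.of_nat (S n))))).
    eapply ex_series_ext; [|exact Hneg]. intros n. cbv beta. f_equal. lia.
Qed.

Lemma Zsum_succ (g : Z -> R) : Zsummable g -> Zsum (fun k => g (Z.succ k)) = Zsum g.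
Proof.
  intros Hg. destruct (Zsummable_succ g Hg) as [_ Hneg']. destruct Hg as [Hpos _]. unfold Zsum.
  rewrite (Series_incr_1 _ Hpos), (Series_incr_1 _ Hneg').
  rewrite (Series_ext (fun n => g (Z.succ (Z.of_nat n))) (fun n => g (Z.of_nat (S n))))
    by (intros; f_equal; lia).
  rewrite (Series_ext (fun n => g (Z.succ (- Z.of_nat (S (S n)))))
                      (fun n => g (- Z.of_nat (S n))%Z)) by (intros; f_equal; lia).
  simpl. ring.
Qed.

Lemma Zsum_shift (g : Z -> R) (m : Z) :
  Zsummable g -> Zsummable (fun k => g (k + m)%Z) /\ Zsum (fun k => g (k + m)%Z) = Zsum g.
Proof.
  intros Hg. induction m as [|m [IH IH']|m [IH IH']] using Z.peano_ind.
  - replace (fun k => g (k + 0)%Z) with g; [now split|].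
    extensionality k. f_equal. ring.
  - replace (fun k => g (k + Z.succ m)%Z) with (fun k => g (Z.succ k + m)%Z)
      by (extensionality k; f_equal; lia).
    split; [exact (Zsummable_succ _ IH)|]. now rewrite <- IH', <- (Zsum_succ _ IH).
  - set (u := fun k => g (- k + m)%Z).
    assert (Hu : Zsummable u) by (exact (Zsummable_opp _ IH)).
    replace (fun k => g (k + Z.pred m)%Z) with (fun k => u (Z.succ (- k)))
      by (extensionality k; unfold u; f_equal; lia).
    assert (Hu' := Zsummable_succ u Hu). split; [exact (Zsummable_opp _ Hu')|].
    rewrite (Zsum_opp (fun k => u (Z.succ k)) Hu'), Zsum_succ by exact Hu.
    unfold u. now rewrite (Zsum_opp (fun k => g (k + m)%Z) IH).
Qed.

Lemma sum_n_incr (b : nat -> R) (m n : nat) :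
  (forall k, 0 <= b k) -> (m <= n)%nat -> sum_n b m <= sum_n b n.
Proof.
  intros Hb. induction 1 as [|n _ IH]; [lra|].
  rewrite sum_Sn. unfold plus; simpl. generalize (Hb (S n)). lra.
Qed.

Lemma ex_series_of_sum_n_le (a : nat -> R) (M : R) :
  (forall n, 0 <= a n) -> (forall n, sum_n a n <= M) -> ex_series a.
Proof.
  intros Ha HM. apply ex_finite_lim_seq_incr with M; [|exact HM].
  intros n. now apply sum_n_incr; [|lia].
Qed.

Lemma ex_series_subseries (b : nat -> R) (phi : nat -> nat) :
  (forall k, 0 <= b k) -> (forall k, (phi k < phi (S k))%nat) ->
  ex_series b -> ex_series (fun k => b (phi k)).
Proof.
  intros Hb Hphi Hs. apply ex_series_of_sum_n_le with (Series b); [intros; apply Hb|].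
  assert (Hle : forall n, sum_n b n <= Series b).
  { intros n. apply (is_lim_seq_incr_compare (sum_n b)).
    - exact (Series_correct b Hs).
    - intros m. apply sum_n_incr; [exact Hb|lia]. }
  intros n. apply Rle_trans with (2 := Hle (phi n)). induction n as [|n IH].
  - rewrite sum_O. destruct (phi O) as [|p]; [rewrite sum_O; lra|].
    rewrite sum_Sn. unfold plus; simpl.
    assert (Hp := sum_n_incr b 0 p Hb ltac:(lia)). rewrite sum_O in Hp.
    generalize (Hb O). lra.
  - specialize (Hphi n). rewrite sum_Sn. unfold plus; simpl.
    destruct (phi (S n)) as [|p]; [lia|]. rewrite sum_Sn. unfold plus; simpl.
    assert (Hp := sum_n_incr b (phi n) p Hb ltac:(lia)). lra.
Qed.

Lemma Zsummable_progression (g : Z -> R) (N : nat) (m : Z) :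
  (0 < N)%nat -> (forall k, 0 <= g k) -> Zsummable g ->
  Zsummable (fun k => g (m + k * Z.of_nat N)%Z).
Proof.
  intros HN Hg Hsum. apply (fun H => proj1 (Zsum_shift g m H)) in Hsum.
  destruct Hsum as [Hpos Hneg]. split.
  - eapply ex_series_ext;
      [|apply (ex_series_subseries _ (fun k => (k * N)%nat)) with (3 := Hpos)].
    + intros k. cbv beta. f_equal. nia.
    + intros; apply Hg.
    + intros; nia.
  - eapply ex_series_ext;
      [|apply (ex_series_subseries _ (fun k => (k * N + (N - 1))%nat)) with (3 := Hneg)].
    + intros k. cbv beta. f_equal. nia.
    + intros; apply Hg.
    + intros; nia.
Qed.

Definition CZsummable (f : Z -> C) : Prop := Zsummable (fun k => Cmod (f k)).

Lemma CZsummable_dominated (f : Z -> C) (b : Z -> R) :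
  (forall k, Cmod (f k) <= b k) -> Zsummable b -> CZsummable f.
Proof.
  intros Hf. apply Zsummable_dominated. intros k. rewrite Rabs_pos_eq by apply Cmod_ge_0. apply Hf.
Qed.

Lemma CZsummable_mult_bounded (f x : Z -> C) :
  CZsummable f -> is_bounded x -> CZsummable (fun k => (f k * x k)%C).
Proof.
  intros Hf [M Hx]. apply CZsummable_dominated with (fun k => Cmod (f k) * M).
  - intros k. rewrite Cmod_mult. apply Rmult_le_compat_l; [apply Cmod_ge_0|apply Hx].
  - now apply Zsummable_scal_r.
Qed.

Lemma CZsummable_opp (f : Z -> C) : CZsummable f -> CZsummable (fun k => f (- k)%Z).
Proof. exact (Zsummable_opp (fun k => Cmod (f k))). Qed.

Lemma CZsummable_shift (f : Z -> C) (m : Z) : CZsummable f -> CZsummable (fun k => f (k + m)%Z).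
Proof. intros Hf. exact (proj1 (Zsum_shift (fun k => Cmod (f k)) m Hf)). Qed.

Lemma CZsummable_progression (f : Z -> C) (N : nat) (m : Z) :
  (0 < N)%nat -> CZsummable f -> CZsummable (fun k => f (m + k * Z.of_nat N)%Z).
Proof.
  intros HN Hf. apply (Zsummable_progression (fun k => Cmod (f k))); [exact HN| |exact Hf].
  intros; apply Cmod_ge_0.
Qed.

Lemma Zsummable_fst (f : Z -> C) : CZsummable f -> Zsummable (fun k => fst (f k)).
Proof. apply Zsummable_dominated. intros; apply Rabs_fst_le_Cmod. Qed.

Lemma Zsummable_snd (f : Z -> C) : CZsummable f -> Zsummable (fun k => snd (f k)).
Proof. apply Zsummable_dominated. intros; apply Rabs_snd_le_Cmod. Qed.

#[local] Hint Resolve Zsummable_fst Zsummable_snd : summable.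

Lemma CZsum_ext (f g : Z -> C) : (forall k, f k = g k) -> CZsum f = CZsum g.
Proof. intros E. f_equal. now apply functional_extensionality. Qed.

Lemma CZsum_plus (f g : Z -> C) :
  CZsummable f -> CZsummable g -> CZsum (fun k => (f k + g k)%C) = (CZsum f + CZsum g)%C.
Proof.
  intros Hf Hg. unfold CZsum, Cplus; cbn [fst snd].
  assert (Zsum_plus : forall u v, Zsummable u -> Zsummable v ->
            Zsum (fun k => u k + v k) = Zsum u + Zsum v).
  { intros u v Hu Hv. rewrite <- (Rmult_1_l (Zsum u)), <- (Rmult_1_l (Zsum v)).
    rewrite <- Zsum_lincomb by assumption. f_equal.
    extensionality k. ring. }
  f_equal; apply Zsum_plus; auto with summable.
Qed.

Lemma CZsum_scal_l (z : C) (f : Z -> C) :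
  CZsummable f -> CZsum (fun k => (z * f k)%C) = (z * CZsum f)%C.
Proof.
  intros Hf. unfold CZsum, Cmult; cbn [fst snd].
  rewrite <- Zsum_lincomb by auto with summable. f_equal.
  transitivity (fst z * Zsum (fun k => fst (f k)) + (- snd z) * Zsum (fun k => snd (f k))); [|ring].
  rewrite <- Zsum_lincomb by auto with summable. f_equal.
  extensionality k. ring.
Qed.

Lemma CZsum_opp (f : Z -> C) : CZsummable f -> CZsum (fun k => f (- k)%Z) = CZsum f.
Proof.
  intros Hf. unfold CZsum. f_equal.
  - apply (Zsum_opp (fun k => fst (f k))). auto with summable.
  - apply (Zsum_opp (fun k => snd (f k))). auto with summable.
Qed.

Lemma CZsum_shift (f : Z -> C) (m : Z) :
  CZsummable f -> CZsum (fun k => f (k + m)%Z) = CZsum f.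
Proof.
  intros Hf. unfold CZsum. f_equal.
  - apply (Zsum_shift (fun k => fst (f k))). auto with summable.
  - apply (Zsum_shift (fun k => snd (f k))). auto with summable.
Qed.

Definition window_sum (K : nat) (f : Z -> C) : C :=
  csum (2 * K) (fun j => f (Z.of_nat j - Z.of_nat K)%Z).

Lemma window_sum_halves (K : nat) (f : Z -> C) :
  window_sum K f
  = (csum K (fun n => f (Z.of_nat n)) + csum K (fun n => f (- Z.of_nat (S n))%Z))%C.
Proof.
  induction K as [|K IH]; [unfold window_sum; simpl; ring|].
  replace (window_sum (S K) f)
    with (window_sum K f + f (Z.of_nat K) + f (- Z.of_nat (S K))%Z)%C.
  - rewrite IH. cbn [csum]. ring.
  - unfold window_sum. replace (2 * S K)%nat with (S (S (2 * K))) by lia.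
    rewrite csum_first. cbn [csum].
    rewrite (csum_ext (2 * K) (fun k => f (Z.of_nat (S k) - Z.of_nat (S K))%Z)
               (fun j => f (Z.of_nat j - Z.of_nat K)%Z)) by (intros; f_equal; lia).
    replace (Z.of_nat (S (2 * K)) - Z.of_nat (S K))%Z with (Z.of_nat K) by lia.
    replace (Z.of_nat 0 - Z.of_nat (S K))%Z with (- Z.of_nat (S K))%Z by lia.
    ring.
Qed.

Lemma Series_tail_small (b : nat -> R) (eps : R) :
  ex_series b -> 0 < eps ->
  exists N, forall n, (N <= n)%nat -> Series (fun k => b (n + k)%nat) <= eps.
Proof.
  intros Hb Heps. assert (Hlim := Series_correct b Hb).
  apply (is_lim_seq_spec (sum_n b) (Series b)) in Hlim.
  destruct (Hlim (mkposreal eps Heps)) as [N HN]. simpl in HN.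
  exists (S N). intros n Hn. specialize (HN (pred n) ltac:(lia)).
  rewrite (Series_incr_n b n) in HN by (auto; lia). rewrite sum_n_Reals in HN.
  apply Rabs_lt_between in HN. lra.
Qed.

(* The window works for all sums dominated by a multiple of [f]; this uniformity makes the
   truncations of a Laurent operator converge in norm. *)
Lemma window_sum_approx (f : Z -> C) (eps : R) :
  CZsummable f -> 0 < eps ->
  exists N, forall K, (N <= K)%nat -> forall (g : Z -> C) (M : R), 0 <= M ->
    (forall k, Cmod (g k) <= Cmod (f k) * M) -> Cmod (CZsum g - window_sum K g) <= eps * M.
Proof.
  intros [Hpos Hneg] Heps.
  destruct (Series_tail_small _ (eps / 4) Hpos) as [N1 HN1]; [lra|].
  destruct (Series_tail_small _ (eps / 4) Hneg) as [N2 HN2]; [lra|].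
  exists (N1 + N2)%nat. intros K HK g M HM Hg.
  set (u := fun n => g (Z.of_nat n)). set (v := fun n => g (- Z.of_nat (S n))%Z).
  change (CZsum g) with (cseries u + cseries v)%C. rewrite window_sum_halves. fold u v.
  replace (cseries u + cseries v - (csum K u + csum K v))%C
    with ((cseries u - csum K u) + (cseries v - csum K v))%C by ring.
  eapply Rle_trans; [apply Cmod_triangle|].
  assert (Hu := Cmod_cseries_minus_csum_le u (fun n => Cmod (f (Z.of_nat n)) * M) K
                  (fun n => Hg _) (ex_series_scal_r M _ Hpos)).
  assert (Hv := Cmod_cseries_minus_csum_le v (fun n => Cmod (f (- Z.of_nat (S n))%Z) * M) K
                  (fun n => Hg _) (ex_series_scal_r M _ Hneg)).
  cbv beta in Hu, Hv. rewrite Series_scal_r in Hu, Hv.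
  assert (Htail1 := HN1 K ltac:(lia)). assert (Htail2 := HN2 K ltac:(lia)).
  apply (Rmult_le_compat_r M _ _ HM) in Htail1, Htail2. lra.
Qed.

Lemma window_sum_lim (f : Z -> C) :
  CZsummable f -> filterlim (fun K => window_sum K f) eventually (locally (CZsum f)).
Proof.
  intros Hf. apply (filterlim_locally_ball_norm (U := C_NormedModule)). intros [eps Heps].
  destruct (window_sum_approx f (eps / 2) Hf) as [N HN]; [lra|].
  exists N. intros K HK. unfold ball_norm. simpl pos.
  change (Cmod (window_sum K f - CZsum f) < eps). rewrite Cmod_minus_sym.
  apply Rle_lt_trans with (eps / 2 * 1); [|lra].
  apply (HN K HK f 1 Rle_0_1). intros; lra.
Qed.

Lemma csum_lim (n : nat) (u : nat -> nat -> C) (l : nat -> C) :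
  (forall j, (j < n)%nat -> filterlim (fun K => u K j) eventually (locally (l j))) ->
  filterlim (fun K => csum n (u K)) eventually (locally (csum n l)).
Proof.
  induction n as [|n IH]; intros Hu; [exact (filterlim_const (RtoC 0))|].
  apply (filterlim_comp_2 (G := locally (csum n l)) (H := locally (l n))
           (fun K => csum n (u K)) (fun K => u K n) Cplus).
  - apply IH. intros; apply Hu; lia.
  - apply Hu. lia.
  - apply (filterlim_plus (V := C_NormedModule)).
Qed.

Lemma CZsum_residues (N : nat) (f : Z -> C) :
  (0 < N)%nat -> CZsummable f ->
  CZsum f = csum N (fun n => CZsum (fun k => f (Z.of_nat n + k * Z.of_nat N)%Z)).
Proof.
  intros HN Hf.
  apply (filterlim_locally_unique (F := eventually) (fun K => window_sum (K * N) f)).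
  - apply (filterlim_comp _ _ _ (fun K => (K * N)%nat) (fun K => window_sum K f) _ eventually).
    + intros P [K0 HK0]. exists K0. intros K HK. apply HK0. nia.
    + now apply window_sum_lim.
  - apply filterlim_ext with
      (fun K => csum N (fun n => window_sum K (fun k => f (Z.of_nat n + k * Z.of_nat N)%Z))).
    + intros K. unfold window_sum. rewrite csum_swap, Nat.mul_assoc, (csum_mul (2 * K) N).
      apply csum_ext. intros i _. apply csum_ext. intros j _. f_equal. nia.
    + apply csum_lim. intros n _. now apply window_sum_lim, CZsummable_progression.
Qed.

(** * Laurent operators and circulant matrices *)

Definition laurent (f : Z -> C) : op := fun x i => CZsum (fun j => (f (i - j)%Z * x j)%C).

Lemma CZsummable_laurent (f x : Z -> C) (i : Z) :
  CZsummable f -> is_bounded x -> CZsummable (fun j => (f (i - j)%Z * x j)%C).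
Proof.
  intros Hf Hx. apply CZsummable_mult_bounded; [|exact Hx].
  replace (fun j => f (i - j)%Z) with (fun j => f (- (j + - i))%Z)
    by (extensionality j; f_equal; ring).
  now apply (CZsummable_shift (fun k => f (- k)%Z)), CZsummable_opp.
Qed.

Lemma laurent_convolution (f x : Z -> C) (i : Z) :
  CZsummable f -> is_bounded x -> laurent f x i = CZsum (fun k => (f k * x (i - k)%Z)%C).
Proof.
  intros Hf Hx. set (g := fun j => (f (i - j)%Z * x j)%C).
  assert (Hg : CZsummable g) by (now apply CZsummable_laurent).
  assert (Hg' : CZsummable (fun k => g (k + i)%Z)) by (now apply CZsummable_shift).
  change (laurent f x i) with (CZsum g).
  rewrite <- (CZsum_shift g i Hg), <- (CZsum_opp _ Hg').
  apply CZsum_ext. intros k. unfold g. do 2 f_equal; ring.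
Qed.

Lemma banded_csum (d n : nat) (T : nat -> op) :
  (forall k, (k < n)%nat -> banded d (T k)) -> banded d (fun x i => csum n (fun k => T k x i)).
Proof.
  induction n as [|n IH]; intros HT; [apply banded_zero|].
  apply (banded_plus d (fun x i => csum n (fun k => T k x i)) (T n)).
  - apply IH. intros; apply HT; lia.
  - apply HT; lia.
Qed.

Lemma band_dominated_laurent (f : Z -> C) : CZsummable f -> band_dominated (laurent f).
Proof.
  intros Hf eps Heps. destruct (window_sum_approx f eps Hf Heps) as [K HK].
  exists K, (fun x i => window_sum K (fun k => (f k * x (i - k)%Z)%C)). split.
  - apply (banded_csum K (2 * K) (fun j x => seq_scal (f (Z.of_nat j - Z.of_nat K)%Z)
                                               (seq_shift (Z.of_nat j - Z.of_nat K)%Z x))).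
    intros j Hj. apply banded_shift. lia.
  - intros x M Hx i. unfold op_minus, seq_minus.
    rewrite laurent_convolution by (auto; now exists M).
    apply HK; [lia|exact (norm_le_nonneg x M Hx)|].
    intros k. rewrite Cmod_mult. apply Rmult_le_compat_l; [apply Cmod_ge_0|apply Hx].
Qed.

Definition periodic {A : Type} (N : nat) (x : Z -> A) : Prop :=
  forall i, x (i + Z.of_nat N)%Z = x i.

Lemma periodic_add_mul {A : Type} (N : nat) (x : Z -> A) (i k : Z) :
  periodic N x -> x (i + k * Z.of_nat N)%Z = x i.
Proof.
  intros Hx. induction k as [|k IH|k IH] using Z.peano_ind.
  - f_equal. ring.
  - rewrite <- IH, <- (Hx (i + k * Z.of_nat N)%Z). f_equal. lia.
  - rewrite <- IH, <- (Hx (i + Z.pred k * Z.of_nat N)%Z). f_equal. lia.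
Qed.

Lemma periodic_mod {A : Type} (N : nat) (x : Z -> A) (i : Z) :
  periodic N x -> x (i mod Z.of_nat N)%Z = x i.
Proof.
  intros Hx. rewrite <- (periodic_add_mul N x (i mod Z.of_nat N) (i / Z.of_nat N) Hx).
  f_equal. rewrite (Z_div_mod_eq_full i (Z.of_nat N)) at 3. ring.
Qed.

Lemma periodic_bounded (N : nat) (x : Z -> C) : (0 < N)%nat -> periodic N x -> is_bounded x.
Proof.
  intros HN Hx.
  assert (Hfinite : forall n, exists M, forall k, (k < n)%nat -> Cmod (x (Z.of_nat k)) <= M).
  { induction n as [|n [M IH]]; [exists 0; intros; lia|].
    exists (Rmax M (Cmod (x (Z.of_nat n)))). intros k Hk.
    destruct (Nat.eq_dec k n) as [->|Hkn]; [apply Rmax_r|].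
    apply Rle_trans with M; [apply IH; lia|apply Rmax_l]. }
  destruct (Hfinite N) as [M HM]. exists M. intros i.
  assert (Hmod := Z.mod_pos_bound i (Z.of_nat N) ltac:(lia)).
  rewrite <- (periodic_mod N x i Hx), <- (Z2Nat.id (i mod Z.of_nat N)) by lia.
  apply HM. lia.
Qed.

Lemma band_dominated_periodic (T : op) (N : nat) (x : Z -> C) :
  band_dominated T -> is_bounded x -> periodic N x -> periodic N (T x).
Proof.
  intros HT Hx HN i. transitivity (seq_shift (- Z.of_nat N) (T x) i).
  - unfold seq_shift. f_equal. ring.
  - rewrite <- band_dominated_map_shift by assumption. f_equal.
    extensionality k. rewrite <- HN. unfold seq_shift. f_equal. ring.
Qed.

Definition periodize (f : Z -> C) (N : nat) (m : Z) : C :=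
  CZsum (fun k => f (m + k * Z.of_nat N)%Z).

Lemma periodize_periodic (f : Z -> C) (N : nat) :
  (0 < N)%nat -> CZsummable f -> periodic N (periodize f N).
Proof.
  intros HN Hf m. unfold periodize.
  rewrite <- (CZsum_shift (fun k => f (m + k * Z.of_nat N)%Z) 1)
    by now apply CZsummable_progression.
  apply CZsum_ext. intros k. f_equal. ring.
Qed.

Definition circulant (f : Z -> C) (N : nat) (u : nat -> C) (r : nat) : C :=
  csum N (fun col => (periodize f N (Z.of_nat ((col + N - r) mod N)) * u col)%C).

(* Row [r] of the circulant pairs the entry of index [col - r] with [u col], while a Laurent
   operator pairs [r - col]: hence the reflections. *)
Lemma circulant_laurent (f x : Z -> C) (N r : nat) :
  CZsummable f -> periodic N x -> (r < N)%nat ->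
  circulant f N (fun col => x (- Z.of_nat col)%Z) r = laurent f x (- Z.of_nat r)%Z.
Proof.
  intros Hf Hx Hr. assert (HN : (0 < N)%nat) by lia.
  assert (Hbounded := periodic_bounded N x HN Hx).
  set (g := fun k => (f k * x (- Z.of_nat r - k)%Z)%C).
  assert (Hg : CZsummable g).
  { apply CZsummable_mult_bounded; [exact Hf|]. destruct Hbounded as [M HM]. exists M.
    intros k. apply HM. }
  rewrite laurent_convolution by assumption. fold g.
  rewrite <- (CZsum_shift g (- Z.of_nat r) Hg), (CZsum_residues N _ HN)
    by now apply CZsummable_shift.
  apply csum_ext. intros col Hcol. rewrite Nat2Z.inj_mod.
  assert (Hper := periodize_periodic f N HN Hf).
  rewrite (periodic_mod N (periodize f N) _ Hper), <- (periodic_add_mul N _ _ (-1) Hper).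
  unfold periodize.
  rewrite Cmult_comm, <- CZsum_scal_l by now apply CZsummable_progression.
  apply CZsum_ext. intros k. unfold g.
  rewrite Cmult_comm, <- (periodic_add_mul N x (- Z.of_nat col) (- k) Hx).
  do 2 f_equal; lia.
Qed.

(** * Block operators and their spectra *)

Definition seq_fst (x : Z -> C * C) : Z -> C := fun i => fst (x i).
Definition seq_snd (x : Z -> C * C) : Z -> C := fun i => snd (x i).

Definition block_op (A B G D : op) (x : Z -> C * C) : Z -> C * C :=
  fun i => (seq_plus (A (seq_fst x)) (B (seq_snd x)) i, seq_plus (G (seq_fst x)) (D (seq_snd x)) i).

Lemma bdd_seq_iff_components (x : Z -> C * C) :
  bdd_seq x <-> is_bounded (seq_fst x) /\ is_bounded (seq_snd x).
Proof.
  split.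
  - intros [M HM]. split; exists M; intros i; apply HM.
  - intros [[M HM] [M' HM']]. exists (Rmax M M'). intros i. split.
    + apply Rle_trans with (2 := Rmax_l _ _), HM.
    + apply Rle_trans with (2 := Rmax_r _ _), HM'.
Qed.

Lemma seq_pair_ext (x y : Z -> C * C) :
  seq_fst x = seq_fst y -> seq_snd x = seq_snd y -> x = y.
Proof.
  intros Hfst Hsnd. extensionality i. apply injective_projections.
  - exact (f_equal (fun z => z i) Hfst).
  - exact (f_equal (fun z => z i) Hsnd).
Qed.

Lemma periodic_components (N : nat) (x : Z -> C * C) :
  periodic N x -> periodic N (seq_fst x) /\ periodic N (seq_snd x).
Proof. intros Hx. split; intros i; unfold seq_fst, seq_snd; now rewrite Hx. Qed.

Definition in_block_spectrum (T : (Z -> C * C) -> Z -> C * C) (lam : C) : Prop :=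
  ~ (forall y, bdd_seq y -> exists! x, bdd_seq x /\
       (forall i, vsub (T x i) (vscal lam (x i)) = y i)).

Lemma in_block_spectrum_ext (T U : (Z -> C * C) -> Z -> C * C) (lam : C) :
  (forall x, bdd_seq x -> T x = U x) -> in_block_spectrum T lam -> in_block_spectrum U lam.
Proof.
  intros E HT HU. apply HT. intros y Hy.
  destruct (HU y Hy) as (x & [Hx Ex] & Hunique). exists x. split.
  - split; [exact Hx|]. now rewrite E.
  - intros x' [Hx' Ex']. apply Hunique. split; [exact Hx'|]. now rewrite <- E.
Qed.

Lemma eigenvalue_in_block_spectrum (T : (Z -> C * C) -> Z -> C * C) (lam : C) (x : Z -> C * C) :
  T (fun _ => (RtoC 0, RtoC 0)) = (fun _ => (RtoC 0, RtoC 0)) ->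
  bdd_seq x -> (exists i, x i <> (RtoC 0, RtoC 0)) -> (forall i, T x i = vscal lam (x i)) ->
  in_block_spectrum T lam.
Proof.
  intros HT0 Hx [i Hi] Heig Hbij. set (zero := fun _ : Z => (RtoC 0, RtoC 0)).
  assert (Hzero : bdd_seq zero).
  { exists 0. intros j. unfold zero; cbn [fst snd]. rewrite Cmod_0. lra. }
  destruct (Hbij zero Hzero) as (z & _ & Hunique). apply Hi.
  change (x i = zero i). rewrite <- (Hunique x), <- (Hunique zero); [reflexivity| |].
  - split; [exact Hzero|]. intros j. unfold zero at 1. rewrite HT0.
    unfold vsub, vscal, zero; cbn [fst snd]. f_equal; ring.
  - split; [exact Hx|]. intros j. rewrite Heig. unfold vsub, zero. f_equal; ring.
Qed.

Definition op_det (A B G D : op) : op := op_minus (op_comp A D) (op_comp B G).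

Section Cramer.

Variables A B G D : op.
Hypothesis HA : band_dominated A.
Hypothesis HB : band_dominated B.
Hypothesis HG : band_dominated G.
Hypothesis HD : band_dominated D.

Lemma band_dominated_op_det : band_dominated (op_det A B G D).
Proof. apply band_dominated_minus; now apply band_dominated_comp. Qed.

Lemma symbol_op_det (t : R) :
  symbol (op_det A B G D) t = (symbol A t * symbol D t - symbol B t * symbol G t)%C.
Proof. rewrite <- !symbol_comp by assumption. reflexivity. Qed.

Lemma cramer_fst (x : Z -> C * C) :
  bdd_seq x ->
  let y := block_op A B G D x in
  op_det A B G D (seq_fst x) = seq_minus (D (seq_fst y)) (B (seq_snd y)).
Proof.
  rewrite bdd_seq_iff_components. intros [Hx1 Hx2] y.
  change (seq_fst y) with (seq_plus (A (seq_fst x)) (B (seq_snd x))).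
  change (seq_snd y) with (seq_plus (G (seq_fst x)) (D (seq_snd x))).
  rewrite (band_dominated_map_plus D), (band_dominated_map_plus B) by auto with bounded.
  rewrite (band_dominated_comm D A), (band_dominated_comm D B) by auto with bounded.
  unfold op_det, op_minus, op_comp. seq_ring.
Qed.

Lemma cramer_snd (x : Z -> C * C) :
  bdd_seq x ->
  let y := block_op A B G D x in
  op_det A B G D (seq_snd x) = seq_minus (A (seq_snd y)) (G (seq_fst y)).
Proof.
  rewrite bdd_seq_iff_components. intros [Hx1 Hx2] y.
  change (seq_fst y) with (seq_plus (A (seq_fst x)) (B (seq_snd x))).
  change (seq_snd y) with (seq_plus (G (seq_fst x)) (D (seq_snd x))).
  rewrite (band_dominated_map_plus A), (band_dominated_map_plus G) by auto with bounded.
  rewrite (band_dominated_comm G A), (band_dominated_comm G B) by auto with bounded.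
  unfold op_det, op_minus, op_comp. seq_ring.
Qed.

Lemma block_op_adjugate (u v : Z -> C) :
  is_bounded u -> is_bounded v ->
  block_op A B G D (fun i => (seq_minus (D u) (B v) i, seq_minus (A v) (G u) i))
  = fun i => (op_det A B G D u i, op_det A B G D v i).
Proof.
  intros Hu Hv. apply seq_pair_ext.
  - change (seq_plus (A (seq_minus (D u) (B v))) (B (seq_minus (A v) (G u)))
            = op_det A B G D u).
    rewrite (band_dominated_map_minus A), (band_dominated_map_minus B) by auto with bounded.
    rewrite (band_dominated_comm B A) by auto with bounded.
    unfold op_det, op_minus, op_comp. seq_ring.
  - change (seq_plus (G (seq_minus (D u) (B v))) (D (seq_minus (A v) (G u)))
            = op_det A B G D v).
    rewrite (band_dominated_map_minus G), (band_dominated_map_minus D) by auto with bounded.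
    rewrite (band_dominated_comm G D), (band_dominated_comm G B), (band_dominated_comm D A)
      by auto with bounded.
    unfold op_det, op_minus, op_comp. seq_ring.
Qed.

Lemma block_op_bijective (y : Z -> C * C) :
  bijective_on_bounded (op_det A B G D) -> bdd_seq y ->
  exists! x, bdd_seq x /\ block_op A B G D x = y.
Proof.
  intros Hdet Hy. destruct (proj1 (bdd_seq_iff_components y) Hy) as [Hy1 Hy2].
  destruct (Hdet (seq_fst y) Hy1) as (u & [Hu Eu] & _).
  destruct (Hdet (seq_snd y) Hy2) as (v & [Hv Ev] & _).
  assert (Hinj : forall x x', is_bounded x -> is_bounded x' ->
            op_det A B G D x = op_det A B G D x' -> x = x').
  { intros x x' Hx Hx' E.
    destruct (Hdet (op_det A B G D x')) as (z & _ & Hunique);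
      [apply bounded_image; [exact band_dominated_op_det|exact Hx']|].
    now rewrite <- (Hunique x), <- (Hunique x'). }
  set (x := fun i => (seq_minus (D u) (B v) i, seq_minus (A v) (G u) i)).
  assert (Hx : bdd_seq x).
  { apply bdd_seq_iff_components. split;
      [change (is_bounded (seq_minus (D u) (B v)))|change (is_bounded (seq_minus (A v) (G u)))];
      auto with bounded. }
  assert (Ex : block_op A B G D x = y).
  { unfold x. rewrite block_op_adjugate, Eu, Ev by assumption. now apply seq_pair_ext. }
  exists x. split; [now split|]. intros x' [Hx' Ex'].
  destruct (proj1 (bdd_seq_iff_components x) Hx) as [Hx1 Hx2].
  destruct (proj1 (bdd_seq_iff_components x') Hx') as [Hx1' Hx2'].
  apply seq_pair_ext; apply Hinj; auto.
  - now rewrite !cramer_fst, Ex, Ex'.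
  - now rewrite !cramer_snd, Ex, Ex'.
Qed.

End Cramer.

Lemma singular_matrix_kernel (p b g d : C) :
  (p * d - b * g)%C = 0 ->
  exists v w : C, (v, w) <> (RtoC 0, RtoC 0) /\ (p * v + b * w)%C = 0 /\ (g * v + d * w)%C = 0.
Proof.
  assert (Hrow : forall r s : C, r <> 0 \/ s <> 0 -> (s, - r)%C <> (RtoC 0, RtoC 0)).
  { intros r s Hrs E. assert (Es := f_equal fst E). assert (Er := f_equal snd E).
    cbn [fst snd] in Es, Er. destruct Hrs as [Hr|Hs]; [|contradiction].
    apply Hr. replace r with (- - r)%C by ring. rewrite Er. ring. }
  intros Hdet. destruct (classic (p <> 0 \/ b <> 0)) as [Hpb|Hpb].
  - exists b, (- p)%C. split; [now apply Hrow|]. split; [ring|].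
    replace (g * b + d * - p)%C with (- (p * d - b * g))%C by ring. rewrite Hdet. ring.
  - apply not_or_and in Hpb. destruct Hpb as [Hp Hb].
    apply NNPP in Hp. apply NNPP in Hb. subst p b.
    destruct (classic (g <> 0 \/ d <> 0)) as [Hgd|Hgd].
    + exists d, (- g)%C. split; [now apply Hrow|]. split; ring.
    + apply not_or_and in Hgd. destruct Hgd as [Hg Hd].
      apply NNPP in Hg. apply NNPP in Hd. subst g d.
      exists (RtoC 1), (RtoC 0). split; [intros E; injection E; lra|]. split; ring.
Qed.

Lemma char_poly_factor (p b g d : C) :
  exists m n : C, forall z, ((p - z) * (d - z) - b * g)%C = ((z - m) * (z - n))%C.
Proof.
  destruct (Csqrt_exists ((p - d) / 2 * ((p - d) / 2) + b * g)%C) as [w Hw].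
  exists ((p + d) / 2 + w)%C, ((p + d) / 2 - w)%C. intros z.
  replace ((z - ((p + d) / 2 + w)) * (z - ((p + d) / 2 - w)))%C
    with ((z - (p + d) / 2) * (z - (p + d) / 2) - w * w)%C by ring.
  rewrite Hw. field.
Qed.

Definition op_sub_scal (T : op) (lam : C) : op := op_minus T (op_scal lam (fun x => x)).

Lemma band_dominated_sub_scal (T : op) (lam : C) :
  band_dominated T -> band_dominated (op_sub_scal T lam).
Proof.
  intros HT. apply band_dominated_minus; [exact HT|]. apply band_dominated_scal, band_dominated_id.
Qed.

Lemma symbol_sub_scal (T : op) (lam : C) (t : R) :
  symbol (op_sub_scal T lam) t = (symbol T t - lam)%C.
Proof.
  unfold symbol, op_sub_scal, op_minus, seq_minus, op_scal, seq_scal. rewrite character_0. ring.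
Qed.

Lemma block_op_sub_scal (A B G D : op) (lam : C) (x : Z -> C * C) (i : Z) :
  block_op (op_sub_scal A lam) B G (op_sub_scal D lam) x i
  = vsub (block_op A B G D x i) (vscal lam (x i)).
Proof.
  unfold block_op, vsub, vscal, op_sub_scal, op_minus, op_scal, seq_plus, seq_minus, seq_scal.
  unfold seq_fst, seq_snd; cbn [fst snd]. f_equal; ring.
Qed.

Definition periodic_eigenvalue (N : nat) (T : (Z -> C * C) -> Z -> C * C) (mu : C) : Prop :=
  exists x, periodic N x /\ (exists i, x i <> (RtoC 0, RtoC 0)) /\
            forall i, T x i = vscal mu (x i).

Section BlockSpectrum.

Variables A B G D : op.
Hypothesis HA : band_dominated A.
Hypothesis HB : band_dominated B.
Hypothesis HG : band_dominated G.
Hypothesis HD : band_dominated D.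

Definition block_char_poly (lam : C) (t : R) : C :=
  ((symbol A t - lam) * (symbol D t - lam) - symbol B t * symbol G t)%C.

Definition block_char_op (lam : C) : op :=
  op_det (op_sub_scal A lam) B G (op_sub_scal D lam).

Lemma band_dominated_char_op (lam : C) : band_dominated (block_char_op lam).
Proof. apply band_dominated_op_det; auto using band_dominated_sub_scal. Qed.

Lemma symbol_char_op (lam : C) (t : R) : symbol (block_char_op lam) t = block_char_poly lam t.
Proof.
  unfold block_char_op. rewrite symbol_op_det by auto using band_dominated_sub_scal.
  now rewrite !symbol_sub_scal.
Qed.

Lemma block_op_zero :
  block_op A B G D (fun _ => (RtoC 0, RtoC 0)) = fun _ => (RtoC 0, RtoC 0).
Proof.
  apply seq_pair_ext.
  - change (seq_plus (A seq_zero) (B seq_zero) = seq_zero).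
    rewrite !band_dominated_map_zero by assumption. seq_ring.
  - change (seq_plus (G seq_zero) (D seq_zero) = seq_zero).
    rewrite !band_dominated_map_zero by assumption. seq_ring.
Qed.

Lemma block_op_character (t : R) (v w : C) (i : Z) :
  block_op A B G D (fun k => (v * character t k, w * character t k)%C) i
  = ((symbol A t * v + symbol B t * w) * character t i,
     (symbol G t * v + symbol D t * w) * character t i)%C.
Proof.
  assert (Hchar : forall T z, band_dominated T ->
            T (seq_scal z (character t)) i = (symbol T t * z * character t i)%C).
  { intros T z HT. rewrite band_dominated_map_scal, band_dominated_map_character
      by auto with bounded.
    unfold seq_scal. ring. }
  change (block_op A B G D (fun k => (v * character t k, w * character t k)%C) i)
    with ((A (seq_scal v (character t)) i + B (seq_scal w (character t)) i)%C,
          (G (seq_scal v (character t)) i + D (seq_scal w (character t)) i)%C).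
  rewrite !Hchar by assumption. f_equal; ring.
Qed.

Lemma block_op_character_eigenvector (lam : C) (t : R) :
  block_char_poly lam t = 0 ->
  exists v w : C, (v, w) <> (RtoC 0, RtoC 0) /\
    let x := fun k => (v * character t k, w * character t k)%C in
    forall i, block_op A B G D x i = vscal lam (x i).
Proof.
  intros Hdet. destruct (singular_matrix_kernel _ _ _ _ Hdet) as (v & w & Hvw & Hfst & Hsnd).
  exists v, w. split; [exact Hvw|]. intros x i. unfold x. rewrite block_op_character.
  unfold vscal; cbn [fst snd]. f_equal.
  - transitivity (((symbol A t - lam) * v + symbol B t * w + lam * v) * character t i)%C; [ring|].
    rewrite Hfst. ring.
  - transitivity ((symbol G t * v + (symbol D t - lam) * w + lam * w) * character t i)%C; [ring|].
    rewrite Hsnd. ring.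
Qed.

Lemma in_block_spectrum_iff_char_poly (lam : C) :
  in_block_spectrum (block_op A B G D) lam <-> exists t, block_char_poly lam t = 0.
Proof.
  split.
  - intros Hspec. apply NNPP. intros Hno. apply Hspec.
    assert (Hbij : bijective_on_bounded (block_char_op lam)).
    { apply wiener_bijective_on_bounded; [apply band_dominated_char_op|].
      intros t E. apply Hno. exists t. now rewrite <- symbol_char_op. }
    intros y Hy.
    destruct (block_op_bijective (op_sub_scal A lam) B G (op_sub_scal D lam)
                (band_dominated_sub_scal A lam HA) HB HG (band_dominated_sub_scal D lam HD)
                y Hbij Hy) as (x & [Hx Ex] & Hunique).
    exists x. split.
    + split; [exact Hx|]. intros i. now rewrite <- block_op_sub_scal, Ex.
    + intros x' [Hx' Ex']. apply Hunique. split; [exact Hx'|].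
      extensionality i. now rewrite block_op_sub_scal.
  - intros [t Ht]. destruct (block_op_character_eigenvector lam t Ht) as (v & w & Hvw & Heig).
    apply eigenvalue_in_block_spectrum with (4 := Heig); [exact block_op_zero| |].
    + apply bdd_seq_iff_components.
      split; [exact (bounded_scal v _ (bounded_character t))
             |exact (bounded_scal w _ (bounded_character t))].
    + exists 0%Z. now rewrite character_0, !Cmult_1_r.
Qed.

Lemma block_char_poly_minus (lam mu : C) (t : R) :
  (block_char_poly lam t - block_char_poly mu t)%C
  = ((lam - mu) * (lam + mu - (symbol A t + symbol D t)))%C.
Proof. unfold block_char_poly. ring. Qed.

Lemma block_spectrum_closed (lam : C) :
  (forall eps, 0 < eps ->
     exists mu, in_block_spectrum (block_op A B G D) mu /\ Cmod (lam - mu) < eps) ->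
  in_block_spectrum (block_op A B G D) lam.
Proof.
  intros Hnear. apply in_block_spectrum_iff_char_poly, NNPP. intros Hno.
  destruct (symbol_bounded_below (block_char_op lam)) as (c & Hc & Hlow).
  { apply band_dominated_char_op. }
  { intros t E. apply Hno. exists t. now rewrite <- symbol_char_op. }
  destruct (band_dominated_opnorm A HA) as (KA & _ & HKA).
  destruct (band_dominated_opnorm D HD) as (KD & _ & HKD).
  destruct (exists_small_mult_le (2 * Cmod lam + 1 + KA + KD) (c / 2)) as (e & He & HKe); [lra|].
  destruct (Hnear e (proj1 He)) as (mu & Hmu & Hdist).
  apply in_block_spectrum_iff_char_poly in Hmu. destruct Hmu as [t Ht].
  assert (Hdiff := block_char_poly_minus lam mu t). rewrite Ht in Hdiff.
  specialize (Hlow t). rewrite symbol_char_op in Hlow.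
  replace (block_char_poly lam t) with (block_char_poly lam t - 0)%C in Hlow by ring.
  rewrite Hdiff, Cmod_mult in Hlow.
  assert (Hfactor : Cmod (lam + mu - (symbol A t + symbol D t)) <= 2 * Cmod lam + 1 + KA + KD).
  { assert (Hmod : Cmod mu <= Cmod lam + 1).
    { replace mu with (lam - (lam - mu))%C by ring.
      generalize (Cmod_minus_le lam (lam - mu)). lra. }
    assert (HAt := Cmod_symbol_le A KA t HKA). assert (HDt := Cmod_symbol_le D KD t HKD).
    eapply Rle_trans; [apply Cmod_minus_le|].
    generalize (Cmod_triangle lam mu) (Cmod_triangle (symbol A t) (symbol D t)). lra. }
  assert (Cmod (lam - mu) * Cmod (lam + mu - (symbol A t + symbol D t))
          <= e * (2 * Cmod lam + 1 + KA + KD))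
    by (apply Rmult_le_compat; try apply Cmod_ge_0; [lra|exact Hfactor]).
  lra.
Qed.

Lemma periodic_eigenvalue_in_block_spectrum (N : nat) (mu : C) :
  (0 < N)%nat -> periodic_eigenvalue N (block_op A B G D) mu ->
  in_block_spectrum (block_op A B G D) mu.
Proof.
  intros HN (x & Hx & Hnz & Heig).
  apply eigenvalue_in_block_spectrum with x; [exact block_op_zero| |exact Hnz|exact Heig].
  apply bdd_seq_iff_components. destruct (periodic_components N x Hx).
  split; now apply periodic_bounded with N.
Qed.

Lemma periodic_eigenvalue_of_char_poly (N : nat) (mu : C) (t : R) :
  character t (Z.of_nat N) = 1 -> block_char_poly mu t = 0 ->
  periodic_eigenvalue N (block_op A B G D) mu.
Proof.
  intros HN Ht. destruct (block_op_character_eigenvector mu t Ht) as (v & w & Hvw & Heig).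
  eexists. split; [|split; [|exact Heig]].
  - intros i. now rewrite character_add, HN, Cmult_1_r.
  - exists 0%Z. now rewrite character_0, !Cmult_1_r.
Qed.

Lemma periodic_eigenvalue_near_block_spectrum (lam : C) (eps : R) :
  in_block_spectrum (block_op A B G D) lam -> 0 < eps ->
  exists N mu, (2 <= N)%nat /\ periodic_eigenvalue N (block_op A B G D) mu /\
               Cmod (lam - mu) < eps.
Proof.
  intros Hlam Heps. apply in_block_spectrum_iff_char_poly in Hlam. destruct Hlam as [t Ht].
  assert (Hcont := Cmod_symbol_continuous (block_char_op lam) t (band_dominated_char_op lam)).
  destruct (Hcont (eps * eps)) as (del & Hdel & Hnear); [nra|].
  destruct (root_angle_dense t del Hdel) as (N & j & HN & Hj). set (s := root_angle N j) in *.
  assert (Hsmall : Cmod (block_char_poly lam s) < eps * eps).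
  { destruct (Req_dec s t) as [->|Hst]; [rewrite Ht, Cmod_0; nra|].
    specialize (Hnear s (conj (conj I (not_eq_sym Hst)) Hj)). simpl in Hnear.
    unfold Rdist in Hnear. rewrite !symbol_char_op, Ht, Cmod_0, Rminus_0_r in Hnear.
    exact (Rle_lt_trans _ _ _ (Rle_abs _) Hnear). }
  destruct (char_poly_factor (symbol A s) (symbol B s) (symbol G s) (symbol D s))
    as (m & n & Hfactor).
  assert (Hroot : forall z, ((z - m) * (z - n))%C = 0 ->
            periodic_eigenvalue N (block_op A B G D) z).
  { intros z Hz. apply periodic_eigenvalue_of_char_poly with s.
    - apply character_root_angle_N. lia.
    - unfold block_char_poly. now rewrite Hfactor. }
  unfold block_char_poly in Hsmall. rewrite Hfactor, Cmod_mult in Hsmall.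
  assert (Hm := Cmod_ge_0 (lam - m)). assert (Hn := Cmod_ge_0 (lam - n)).
  destruct (Rlt_le_dec (Cmod (lam - m)) eps) as [Hlt|Hle].
  - exists N, m. split; [exact HN|]. split; [apply Hroot; ring|exact Hlt].
  - exists N, n. split; [exact HN|]. split; [apply Hroot; ring|]. nra.
Qed.

Theorem block_spectrum_closure_periodic_eigenvalues (lam : C) :
  in_block_spectrum (block_op A B G D) lam <->
  (forall eps, 0 < eps ->
     exists N mu, (2 <= N)%nat /\ periodic_eigenvalue N (block_op A B G D) mu /\
                  Cmod (lam - mu) < eps).
Proof.
  split.
  - intros Hlam eps Heps. now apply periodic_eigenvalue_near_block_spectrum.
  - intros Hnear. apply block_spectrum_closed. intros eps Heps.
    destruct (Hnear eps Heps) as (N & mu & HN & Hmu & Hdist).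
    exists mu. split; [|exact Hdist].
    apply periodic_eigenvalue_in_block_spectrum with N; [lia|exact Hmu].
Qed.

End BlockSpectrum.

(** * Block circulant matrices *)

Section BlockCirculant.

Variables fA fB fG fD : Z -> C.
Hypothesis HfA : CZsummable fA.
Hypothesis HfB : CZsummable fB.
Hypothesis HfG : CZsummable fG.
Hypothesis HfD : CZsummable fD.

Definition block_laurent : (Z -> C * C) -> Z -> C * C :=
  block_op (laurent fA) (laurent fB) (laurent fG) (laurent fD).

Definition block_circulant (N : nat) (v : nat -> C * C) (r : nat) : C * C :=
  ((circulant fA N (fun k => fst (v k)) r + circulant fB N (fun k => snd (v k)) r)%C,
   (circulant fG N (fun k => fst (v k)) r + circulant fD N (fun k => snd (v k)) r)%C).

Lemma block_circulant_ext (N : nat) (v w : nat -> C * C) (r : nat) :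
  (forall k, (k < N)%nat -> v k = w k) -> block_circulant N v r = block_circulant N w r.
Proof.
  intros E. unfold block_circulant, circulant.
  f_equal; f_equal; apply csum_ext; intros k Hk; now rewrite E.
Qed.

Lemma block_circulant_laurent (N r : nat) (x : Z -> C * C) :
  periodic N x -> (r < N)%nat ->
  block_circulant N (fun col => x (- Z.of_nat col)%Z) r = block_laurent x (- Z.of_nat r)%Z.
Proof.
  intros Hx Hr. unfold block_laurent, block_op, seq_plus.
  destruct (periodic_components N x Hx) as [Hfst Hsnd].
  rewrite <- !(circulant_laurent _ (seq_fst x) N r), <- !(circulant_laurent _ (seq_snd x) N r)
    by assumption.
  reflexivity.
Qed.

Lemma periodic_of_residues (N : nat) (i : Z) :
  (0 < N)%nat -> exists r k, (r < N)%nat /\ i = (- Z.of_nat r + k * Z.of_nat N)%Z.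
Proof.
  intros HN. assert (Hmod := Z.mod_pos_bound (- i) (Z.of_nat N) ltac:(lia)).
  exists (Z.to_nat ((- i) mod Z.of_nat N)), (- ((- i) / Z.of_nat N))%Z. split; [lia|].
  rewrite Z2Nat.id by lia. generalize (Z_div_mod_eq_full (- i) (Z.of_nat N)). lia.
Qed.

Lemma block_laurent_periodic (N : nat) (x : Z -> C * C) :
  (0 < N)%nat -> periodic N x -> periodic N (block_laurent x).
Proof.
  intros HN Hx.
  destruct (periodic_components N x Hx) as [Hfst Hsnd].
  assert (Hlaurent : forall f u, CZsummable f -> periodic N u -> periodic N (laurent f u)).
  { intros f u Hf Hu. apply band_dominated_periodic; [now apply band_dominated_laurent| |exact Hu].
    now apply periodic_bounded with N. }
  intros i. unfold block_laurent, block_op, seq_plus. now rewrite !Hlaurent.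
Qed.

Lemma block_circulant_eigenvalue_iff (N : nat) (mu : C) :
  (0 < N)%nat ->
  (exists v, (exists r, (r < N)%nat /\ v r <> (RtoC 0, RtoC 0)) /\
     forall r, (r < N)%nat -> block_circulant N v r = vscal mu (v r))
  <-> periodic_eigenvalue N block_laurent mu.
Proof.
  intros HN. split.
  - intros (v & (r0 & Hr0 & Hv) & Heig).
    set (x := fun i => v (Z.to_nat ((- i) mod Z.of_nat N))).
    assert (Hx : periodic N x).
    { intros i. unfold x. do 2 f_equal.
      replace (- (i + Z.of_nat N))%Z with (- i + (- 1) * Z.of_nat N)%Z by ring.
      apply Z_mod_plus_full. }
    assert (Hxv : forall r, (r < N)%nat -> x (- Z.of_nat r)%Z = v r).
    { intros r Hr. unfold x. f_equal. rewrite Z.opp_involutive, Z.mod_small by lia.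
      apply Nat2Z.id. }
    exists x. split; [exact Hx|]. split; [exists (- Z.of_nat r0)%Z; now rewrite Hxv|].
    intros i. destruct (periodic_of_residues N i HN) as (r & k & Hr & ->).
    rewrite (periodic_add_mul N x), (periodic_add_mul N (block_laurent x))
      by auto using block_laurent_periodic.
    rewrite <- (block_circulant_laurent N), Hxv, <- Heig by assumption.
    apply block_circulant_ext. exact Hxv.
  - intros (x & Hx & (i & Hi) & Heig). exists (fun r => x (- Z.of_nat r)%Z). split.
    + destruct (periodic_of_residues N i HN) as (r & k & Hr & ->).
      exists r. split; [exact Hr|]. now rewrite <- (periodic_add_mul N x _ k Hx).
    + intros r Hr. now rewrite block_circulant_laurent.
Qed.

End BlockCirculant.

(** * Lattice samples of a decaying function *)

Lemma Rpower_le_contravar_l (x y p : R) : p <= 0 -> 0 < x <= y -> Rpower y p <= Rpower x p.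
Proof.
  intros Hp Hxy. rewrite <- (Ropp_involutive p), !(Rpower_Ropp _ (- p)).
  apply Rinv_le_contravar; [apply exp_pos|]. apply Rle_Rpower_l; lra.
Qed.

Lemma Rpower_telescope_le (x delta : R) :
  0 < x -> 0 < delta ->
  delta * Rpower (x + 1) (- 1 - delta) <= Rpower x (- delta) - Rpower (x + 1) (- delta).
Proof.
  intros Hx Hdelta. set (y := x + 1). assert (Hy : 0 < y) by (unfold y; lra).
  assert (Hpow : Rpower y (- 1 - delta) = Rpower y (- delta) * / y).
  { replace (- 1 - delta) with (- delta + - (1)) by ring.
    rewrite Rpower_plus, (Rpower_Ropp y 1), Rpower_1 by exact Hy. reflexivity. }
  assert (Hratio : Rpower x (- delta) = Rpower y (- delta) * exp (delta * (ln y - ln x))).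
  { unfold Rpower. rewrite <- exp_plus. f_equal. ring. }
  assert (Hln : / y <= ln y - ln x).
  { assert (Hexp := exp_ineq1_le (ln (x / y))).
    rewrite exp_ln, ln_div in Hexp by (try apply Rdiv_lt_0_compat; assumption).
    assert (x / y = 1 - / y) by (unfold y; field; unfold y in Hy; lra). lra. }
  assert (Hexp := exp_ineq1_le (delta * (ln y - ln x))).
  rewrite Hpow, Hratio. assert (Hpos : 0 < Rpower y (- delta)) by apply exp_pos.
  assert (delta * / y <= delta * (ln y - ln x)) by (apply Rmult_le_compat_l; lra).
  nra.
Qed.

Lemma ex_series_Rpower (delta : R) :
  0 < delta -> ex_series (fun n => Rpower (INR (S n)) (- 1 - delta)).
Proof.
  intros Hdelta. assert (Hinv : 0 < / delta) by (now apply Rinv_0_lt_compat).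
  assert (Hpow1 : forall p, Rpower 1 p = 1)
    by (intros; unfold Rpower; now rewrite ln_1, Rmult_0_r, exp_0).
  apply ex_series_of_sum_n_le with (1 + / delta).
  { intros n. apply Rlt_le, exp_pos. }
  intros n.
  apply Rle_trans with (1 + / delta * (1 - Rpower (INR (S n)) (- delta))).
  - induction n as [|n IH]; [rewrite sum_O; simpl INR; rewrite !Hpow1; lra|].
    rewrite sum_Sn. unfold plus; simpl.
    assert (Htel := Rpower_telescope_le (INR (S n)) delta ltac:(apply lt_0_INR; lia) Hdelta).
    rewrite <- S_INR in Htel. apply (Rmult_le_compat_l (/ delta)) in Htel; [|lra].
    rewrite <- Rmult_assoc, Rinv_l, Rmult_1_l in Htel by lra.
    cbn [INR] in *. lra.
  - assert (0 < Rpower (INR (S n)) (- delta)) by apply exp_pos. nra.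
Qed.

Lemma Zsummable_Rpower (delta : R) :
  0 < delta -> Zsummable (fun k => Rpower (1 + Rabs (IZR k)) (- 1 - delta)).
Proof.
  intros Hdelta. assert (Hser := ex_series_Rpower delta Hdelta). split.
  - eapply ex_series_ext; [|exact Hser]. intros n. cbv beta. f_equal.
    rewrite <- INR_IZR_INZ, Rabs_pos_eq, S_INR by apply pos_INR. ring.
  - apply ex_series_incr_1 in Hser. eapply ex_series_ext; [|exact Hser]. intros n. cbv beta.
    rewrite opp_IZR, Rabs_Ropp, <- INR_IZR_INZ, Rabs_pos_eq by apply pos_INR.
    now rewrite (S_INR (S n)), Rplus_comm.
Qed.

Definition lattice_samples (f : R -> R) (T s : R) (k : Z) : C := RtoC (f (s + IZR k * T)).

Lemma CZsummable_lattice_samples (f : R -> R) (T s K delta : R) :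
  0 < T -> 0 < delta -> (forall x, Rabs (f x) <= K * Rpower (1 + Rabs x) (- 1 - delta)) ->
  CZsummable (lattice_samples f T s).
Proof.
  intros HT Hdelta Hf. assert (Hs := Rabs_pos s).
  assert (HK : 0 <= K).
  { assert (Hf0 := Hf 0). assert (Hpos : 0 < Rpower (1 + Rabs 0) (- 1 - delta)) by apply exp_pos.
    generalize (Rabs_pos (f 0)). nra. }
  set (m := Rmin 1 T / (1 + Rabs s)).
  assert (Hmin : 0 < Rmin 1 T) by (apply Rmin_pos; lra).
  assert (Hm : 0 < m) by (apply Rdiv_lt_0_compat; lra).
  assert (Hgrowth : forall k, m * (1 + Rabs (IZR k)) <= 1 + Rabs (s + IZR k * T)).
  { intros k. apply Rmult_le_reg_l with (1 + Rabs s); [lra|].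
    replace ((1 + Rabs s) * (m * (1 + Rabs (IZR k)))) with (Rmin 1 T * (1 + Rabs (IZR k)))
      by (unfold m; field; lra).
    assert (Htri : Rabs (IZR k) * T <= Rabs (s + IZR k * T) + Rabs s).
    { rewrite <- (Rabs_pos_eq T) at 1 by lra. rewrite <- Rabs_mult.
      replace (IZR k * T) with ((s + IZR k * T) - s) at 1 by ring.
      apply Rle_trans with (1 := Rabs_triang _ _). rewrite Rabs_Ropp. lra. }
    generalize (Rmin_l 1 T) (Rmin_r 1 T) (Rabs_pos (IZR k)) (Rabs_pos (s + IZR k * T)). nra. }
  apply CZsummable_dominated with
    (fun k => Rpower (1 + Rabs (IZR k)) (- 1 - delta) * (K * Rpower m (- 1 - delta))).
  - intros k. unfold lattice_samples. rewrite Cmod_R.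
    apply Rle_trans with (1 := Hf _).
    rewrite (Rmult_comm (Rpower _ _)), Rmult_assoc. apply Rmult_le_compat_l; [exact HK|].
    assert (Hk := Rabs_pos (IZR k)).
    rewrite Rpower_mult_distr by lra. apply Rpower_le_contravar_l; [lra|].
    split; [apply Rmult_lt_0_compat; lra|apply Hgrowth].
  - now apply Zsummable_scal_r, Zsummable_Rpower.
Qed.

Lemma CZsum_RtoC (g : Z -> R) : CZsum (fun k => RtoC (g k)) = RtoC (Zsum g).
Proof.
  unfold CZsum, RtoC; cbn [fst snd]. f_equal. unfold Zsum.
  rewrite (Series_ext (fun _ => 0) (fun _ => 0 * 0)), Series_scal_l by (intros; ring). ring.
Qed.

Lemma omega_p_div (f : R -> R) (x P c : R) :
  omega_p f x P / c = omega_p (fun y => f y / c) x P.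
Proof. unfold omega_p, Zsum, Rdiv. now rewrite !Series_scal_r, Rmult_plus_distr_r. Qed.

Lemma omega_p_lattice_samples (f : R -> R) (T s : R) (N m : nat) :
  (0 < N)%nat -> CZsummable (lattice_samples f T s) ->
  RtoC (omega_p f (s + INR m * T) (INR N * T))
  = periodize (lattice_samples f T s) N (Z.of_nat m).
Proof.
  intros HN Hf. unfold periodize.
  rewrite <- CZsum_opp by now apply CZsummable_progression.
  unfold omega_p. rewrite <- CZsum_RtoC. apply CZsum_ext. intros k. unfold lattice_samples.
  do 2 f_equal. rewrite plus_IZR, mult_IZR, opp_IZR, <- !INR_IZR_INZ. ring.
Qed.

(** * The spectra of [L] and of [L(1+q)] *)

Lemma fst_vsum (n : nat) (F : nat -> C * C) : fst (vsum n F) = csum n (fun k => fst (F k)).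
Proof. induction n as [|n IH]; simpl; [reflexivity|]. now rewrite IH. Qed.

Lemma snd_vsum (n : nat) (F : nat -> C * C) : snd (vsum n F) = csum n (fun k => snd (F k)).
Proof. induction n as [|n IH]; simpl; [reflexivity|]. now rewrite IH. Qed.

Section KernelBlocks.

Variables (omega : R -> R) (T a c : R).

Definition kernel_samples (s : R) : Z -> C := lattice_samples (fun x => omega x / c) T s.

Hypothesis summable_kernel_samples : forall s, CZsummable (kernel_samples s).

Definition kernel_laurent : (Z -> C * C) -> Z -> C * C :=
  block_laurent (kernel_samples 0) (kernel_samples (-2 * a)) (kernel_samples (2 * a))
                (kernel_samples 0).

Lemma Lop_kernel_laurent (x : Z -> C * C) :
  bdd_seq x -> Lop omega T a c x = kernel_laurent x.
Proof.
  rewrite bdd_seq_iff_components. intros [Hfst Hsnd]. extensionality i.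
  unfold Lop, kernel_laurent, block_laurent, block_op, seq_plus, laurent.
  rewrite <- !CZsum_plus by (apply CZsummable_laurent; auto).
  f_equal; apply CZsum_ext; intros j; unfold blk, kernel_samples, lattice_samples;
    cbn [fst snd]; now rewrite Rplus_0_l.
Qed.

Lemma omega_p_kernel_samples (s : R) (N m : nat) :
  (0 < N)%nat ->
  RtoC (omega_p omega (s + INR m * T) (INR N * T) / c)
  = periodize (kernel_samples s) N (Z.of_nat m).
Proof.
  intros HN. rewrite omega_p_div. apply omega_p_lattice_samples; [exact HN|].
  apply summable_kernel_samples.
Qed.

Lemma circ_apply_block_circulant (q : nat) (v : nat -> C * C) (r : nat) :
  circ_apply omega T a c q v r
  = block_circulant (kernel_samples 0) (kernel_samples (-2 * a)) (kernel_samples (2 * a))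
                    (kernel_samples 0) (S q) v r.
Proof.
  assert (Hdiag : forall m, RtoC (omega_p omega (INR m * T) (INR (S q) * T) / c)
                            = periodize (kernel_samples 0) (S q) (Z.of_nat m)).
  { intros m. rewrite <- omega_p_kernel_samples by lia. now rewrite Rplus_0_l. }
  unfold circ_apply, block_circulant, circulant. rewrite <- !csum_plus.
  apply injective_projections; [rewrite fst_vsum|rewrite snd_vsum]; apply csum_ext;
    intros col _; unfold blk; cbn [fst snd];
    now rewrite Hdiag, omega_p_kernel_samples by lia.
Qed.

Lemma in_spectrum_L_iff (lam : C) :
  in_spectrum_L omega T a c lam <-> in_block_spectrum kernel_laurent lam.
Proof.
  split; apply in_block_spectrum_ext; intros x Hx; [|symmetry]; now apply Lop_kernel_laurent.
Qed.

Lemma in_spectrum_circ_iff (q : nat) (mu : C) :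
  in_spectrum_circ omega T a c q mu <-> periodic_eigenvalue (S q) kernel_laurent mu.
Proof.
  unfold in_spectrum_circ, kernel_laurent. rewrite <- block_circulant_eigenvalue_iff by (auto; lia).
  split; intros (v & Hv & Heig); exists v; (split; [exact Hv|]); intros r Hr.
  - now rewrite <- circ_apply_block_circulant, Heig.
  - now rewrite circ_apply_block_circulant, Heig.
Qed.

Theorem in_spectrum_L_iff_limit_circulant (lam : C) :
  in_spectrum_L omega T a c lam <->
  (forall eps, 0 < eps ->
     exists q mu, (1 <= q)%nat /\ in_spectrum_circ omega T a c q mu /\ Cmod (lam - mu) < eps).
Proof.
  rewrite in_spectrum_L_iff.
  unfold kernel_laurent, block_laurent.
  rewrite block_spectrum_closure_periodic_eigenvalues by now apply band_dominated_laurent.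
  split; intros Hnear eps Heps.
  - destruct (Hnear eps Heps) as ([|q] & mu & HN & Hmu & Hdist); [lia|].
    exists q, mu. split; [lia|]. split; [now apply in_spectrum_circ_iff|exact Hdist].
  - destruct (Hnear eps Heps) as (q & mu & Hq & Hmu & Hdist).
    exists (S q), mu. split; [lia|]. split; [now apply in_spectrum_circ_iff|exact Hdist].
Qed.

End KernelBlocks.

Theorem theorem4
  (omega : R -> R)
  (* (i) even *)
  (Heven : forall x, omega (- x) = omega x)
  (* (ii) decay *)
  (Hlim : filterlim omega (Rbar_locally p_infty) (locally 0) /\
          filterlim omega (Rbar_locally m_infty) (locally 0))
  (Hdecay : exists C0 delta : R, 0 < C0 /\ 0 < delta /\
              forall x, Rabs (omega x) <= C0 * Rpower (1 + Rabs x) (- 1 - delta))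
  (* (iii) bounded, Lipschitz, integrable *)
  (Hbdd : exists M : R, forall x, Rabs (omega x) <= M)
  (Hlip : exists K : R, forall x y, Rabs (omega x - omega y) <= K * Rabs (x - y))
  (Hint : ex_RInt_gen (fun x => Rabs (omega x)) (Rbar_locally m_infty) (Rbar_locally p_infty))
  (* (iv) positive mass *)
  (Hpos : exists I : R, is_RInt_gen omega (Rbar_locally m_infty) (Rbar_locally p_infty) I
                        /\ 0 < I)
  (h T a : R) (up : R -> R)
  (HT : 0 < T)
  (Ha : 0 < a /\ a < T / 2)
  (* up is continuous, T-periodic, bounded, with bounded continuous derivative *)
  (Hcont : forall x, continuous up x)
  (Hper : forall x, up (x + T) = up x)
  (Hubdd : exists M : R, forall x, Rabs (up x) <= M)
  (Hder : forall x, ex_derive up x)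
  (Hdcont : forall x, continuous (Derive up) x)
  (Hdbdd : exists M : R, forall x, Rabs (Derive up x) <= M)
  (* regular 1-bump shape, threshold h *)
  (Hpa : up a = h) (Hma : up (- a) = h)
  (Hin : forall x, - a < x < a -> up x > h)
  (Hout : forall x, - T / 2 <= x <= T / 2 -> ~ (- a <= x <= a) -> up x < h)
  (Hdpa : Derive up a <> 0) (Hdma : Derive up (- a) <> 0)
  (* up solves the integral equation *)
  (Hsol : forall x, is_RInt_gen (fun y => omega (x - y) * H (up y - h))
                      (Rbar_locally m_infty) (Rbar_locally p_infty) (up x)) :
  forall lam : C,
    in_spectrum_L omega T a (Rabs (Derive up a)) lam <->
    (forall eps : R, 0 < eps ->
       exists (q : nat) (mu : C), (1 <= q)%nat /\
         in_spectrum_circ omega T a (Rabs (Derive up a)) q mu /\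
         Cmod (Cminus lam mu) < eps).
Proof.
  destruct Hdecay as (C0 & delta & HC0 & Hdelta & Hdec).
  apply in_spectrum_L_iff_limit_circulant. intros s. set (c := Rabs (Derive up a)).
  apply CZsummable_lattice_samples with (C0 * Rabs (/ c)) delta; try assumption.
  intros x. unfold Rdiv. rewrite Rabs_mult, Rmult_assoc, (Rmult_comm (Rabs (/ c))), <- Rmult_assoc.
  apply Rmult_le_compat_r; [apply Rabs_pos|apply Hdec].
Qed.
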